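(* Let $A$ be a noetherian Krull domain, $B:=A[[t]]$, and let $M$ be a finitely generated torsion $B$-module. Write $M_t:=\{m\in M: tm=0\}$ and assume that $M/tM$ is a finitely generated torsion $A$-module. Then $M$ is a pseudo-null $B$-module if and only if $Ch_A(M_t)=Ch_A(M/tM)$. Moreover, if $M/tM$ is a pseudo-null $A$-module, then $M$ is a pseudo-null $B$-module.
   Context: A Krull domain is an integral domain $R$ such that $R=\bigcap R_{\mathfrak p}$ over all height 1 primes $\mathfrak p$, each such $R_{\mathfrak p}$ is a discrete valuation ring, and every nonzero $x\in R$ is a unit in $R_{\mathfrak p}$ for almost all $\mathfrak p$. If $A$ is a noetherian Krull domain, then so is $B=A[[t]]$. Let $R$ be a noetherian Krull domain. A finitely generated torsion $R$-module is pseudo-null if its annihilator has height at least 2 (equivalently, its localizations at all height 1 primes vanish); the zero module is pseudo-null. A pseudo-isomorphism is a morphism with pseudo-null kernel and cokernel. For every finitely generated torsion $R$-module $M$ there is a pseudo-isomorphism $M\to\bigoplus_{i=1}^n R/\mathfrak p_i^{e_i}$ with $\mathfrak p_i$ height 1 primes (not necessarily distinct); the $\mathfrak p_i$, $e_i$ and $n$ are uniquely determined by $M$. Characteristic ideal of a finitely generated $R$-module $M$: $Ch_R(M):=0$ if $M$ is not torsion, and $Ch_R(M):=\prod_{i=1}^n\mathfrak p_i^{e_i}$ if $M$ is torsion and pseudo-isomorphic to $\bigoplus_{i=1}^n R/\mathfrak p_i^{e_i}$. The exponent of a height 1 prime $\mathfrak p$ in $Ch_R(M)$ is the length of $M\otimes_R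 R_{\mathfrak p}$. *)

(* Defs.v *)
From HB Require Import structures.
From mathcomp Require Import all_boot all_order all_algebra.
From mathcomp Require Import boolp classical_sets functions cardinality.

Set Implicit Arguments.
Unset Strict Implicit.
Unset Printing Implicit Defensive.

Import Order.TTheory GRing.Theory Num.Theory.

Local Open Scope classical_set_scope.
Local Open Scope ring_scope.

Section Submodule.
Variables (R : pzRingType) (V : lmodType R) (S : submodClosed V).

Record submodule := Submodule { submodule_val : V; _ : submodule_val \in S }.

HB.instance Definition _ := [isSub for submodule_val].
HB.instance Definition _ := [Choice of submodule by <:].
HB.instance Definition _ :=
  GRing.SubChoice_isSubLmodule.Build R V _ submodule (GRing.subsemimodClosedP S).

End Submodule.

Section QuotientModule.
Local Open Scope quotient_scope.
Variables (R : pzRingType) (V : lmodType R) (S : submodClosed V).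

(* [submodClosed] does not inherit from [zmodClosed], which [Quotient.quot]
   requires. *)
Definition submod_pred : {pred V} := fun x => x \in S.
HB.instance Definition _ := GRing.isZmodClosed.Build V submod_pred
  (GRing.subsemimod_closedB (GRing.subsemimodClosedP S)).

Definition quotmodule : Type := Quotient.quot submod_pred.
HB.instance Definition _ := Quotient.on quotmodule.
HB.instance Definition _ := GRing.Zmodule.on quotmodule.

Definition quotmodule_scale (a : R) (x : quotmodule) : quotmodule :=
  \pi_quotmodule (a *: repr x).

Lemma pi_quotmoduleE (u v : V) :
  (\pi_quotmodule u == \pi_quotmodule v) = (u - v \in S).
Proof. by have := Quotient.idealrBE submod_pred u v; rewrite /= => ->. Qed.

Lemma pi_quotmoduleD (u v : V) :
  \pi_quotmodule (u + v) = \pi_quotmodule u + \pi_quotmodule v.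
Proof. exact: (@Quotient.pi_add V submod_pred u v). Qed.

Lemma quotmodule_scaleE (a : R) (u : V) :
  quotmodule_scale a (\pi_quotmodule u) = \pi_quotmodule (a *: u).
Proof.
apply/eqP; rewrite /quotmodule_scale pi_quotmoduleE -scalerBr rpredZ //.
by rewrite -pi_quotmoduleE reprK.
Qed.

Fact quotmodule_scaleA a b x :
  quotmodule_scale a (quotmodule_scale b x) = quotmodule_scale (a * b) x.
Proof.
by elim/quotW: x => x; rewrite (quotmodule_scaleE b x) !quotmodule_scaleE scalerA. Qed.

Fact quotmodule_scale1 : left_id 1 quotmodule_scale.
Proof. by move=> x; elim/quotW: x => x; rewrite quotmodule_scaleE scale1r. Qed.

Fact quotmodule_scaleDr : right_distributive quotmodule_scale +%R.
Proof.
move=> a x y; elim/quotW: x => x; elim/quotW: y => y; rewrite -pi_quotmoduleD.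
rewrite !quotmodule_scaleE.
by rewrite scalerDr pi_quotmoduleD.
Qed.

Fact quotmodule_scaleDl x : {morph quotmodule_scale^~ x : a b / a + b}.
Proof.
by elim/quotW: x => x a b; rewrite !quotmodule_scaleE scalerDl pi_quotmoduleD.
Qed.

HB.instance Definition _ := GRing.Zmodule_isLmodule.Build R quotmodule
  quotmodule_scaleA quotmodule_scale1 quotmodule_scaleDr quotmodule_scaleDl.

End QuotientModule.

(* The index type is finite, so the direct sum is the full product. *)
Section DirectSum.
Variables (R : pzRingType) (I : finType) (V : I -> lmodType R).

Definition direct_sum : Type := forall i, V i.
HB.instance Definition _ := gen_eqMixin direct_sum.
HB.instance Definition _ := gen_choiceMixin direct_sum.

Implicit Types f g h : direct_sum.
Definition dsum_zero : direct_sum := fun i => 0.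
Definition dsum_opp f : direct_sum := fun i => - f i.
Definition dsum_add f g : direct_sum := fun i => f i + g i.
Definition dsum_scale (a : R) f : direct_sum := fun i => a *: f i.

Fact dsum_addA : associative dsum_add.
Proof. by move=> f g h; apply: functional_extensionality_dep => i; exact: addrA. Qed.
Fact dsum_addC : commutative dsum_add.
Proof. by move=> f g; apply: functional_extensionality_dep => i; exact: addrC. Qed.
Fact dsum_add0 : left_id dsum_zero dsum_add.
Proof. by move=> f; apply: functional_extensionality_dep => i; exact: add0r. Qed.
Fact dsum_addN : left_inverse dsum_zero dsum_opp dsum_add.
Proof. by move=> f; apply: functional_extensionality_dep => i; exact: addNr. Qed.
HB.instance Definition _ := GRing.isZmodule.Build direct_sum
  dsum_addA dsum_addC dsum_add0 dsum_addN.

Fact dsum_scaleA a b f : dsum_scale a (dsum_scale b f) = dsum_scale (a * b) f.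
Proof. by apply: functional_extensionality_dep => i; exact: scalerA. Qed.
Fact dsum_scale1 : left_id 1 dsum_scale.
Proof. by move=> f; apply: functional_extensionality_dep => i; exact: scale1r. Qed.
Fact dsum_scaleDr : right_distributive dsum_scale +%R.
Proof. by move=> a f g; apply: functional_extensionality_dep => i; exact: scalerDr. Qed.
Fact dsum_scaleDl f : {morph dsum_scale^~ f : a b / a + b}.
Proof. by move=> a b; apply: functional_extensionality_dep => i; exact: scalerDl. Qed.
HB.instance Definition _ := GRing.Zmodule_isLmodule.Build R direct_sum
  dsum_scaleA dsum_scale1 dsum_scaleDr dsum_scaleDl.

End DirectSum.

Section RestrictScalars.
Variables (R S : pzRingType) (phi : {rmorphism R -> S}) (M : lmodType S).

Definition restrict_scalars of {rmorphism R -> S} : Type := M.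
Local Notation rM := (restrict_scalars phi).
HB.instance Definition _ := GRing.Zmodule.on rM.

Definition restrict_scale (a : R) (m : rM) : rM := phi a *: (m : M).

Fact restrict_scaleA a b m :
  restrict_scale a (restrict_scale b m) = restrict_scale (a * b) m.
Proof. by rewrite /restrict_scale scalerA rmorphM. Qed.
Fact restrict_scale1 : left_id 1 restrict_scale.
Proof. by move=> m; rewrite /restrict_scale rmorph1 scale1r. Qed.
Fact restrict_scaleDr : right_distributive restrict_scale +%R.
Proof. by move=> a m n; exact: scalerDr. Qed.
Fact restrict_scaleDl m : {morph restrict_scale^~ m : a b / a + b}.
Proof. by move=> a b; rewrite /restrict_scale rmorphD scalerDl. Qed.
HB.instance Definition _ := GRing.Zmodule_isLmodule.Build R rM
  restrict_scaleA restrict_scale1 restrict_scaleDr restrict_scaleDl.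

End RestrictScalars.

Section KernelImage.
Variables (R : pzRingType) (M N : lmodType R) (f : {linear M -> N}).

Definition lin_kernel : {pred M} := fun x => f x == 0.
Definition lin_image : {pred N} := fun y => `[< exists x, y = f x >].

Fact lin_kernel_closed : submod_closed lin_kernel.
Proof.
split=> [|a x y]; rewrite !unfold_in ?linear0 //.
by move=> /eqP fx /eqP fy; rewrite linearP fx fy scaler0 addr0.
Qed.
HB.instance Definition _ := GRing.isSubmodClosed.Build R M lin_kernel
  lin_kernel_closed.

Fact lin_image_closed : submod_closed lin_image.
Proof.
split=> [|a x y]; rewrite !unfold_in.
  by apply/asboolP; exists 0; rewrite linear0.
move=> /asboolP[u ->] /asboolP[v ->]; apply/asboolP.
by exists (a *: u + v); rewrite linearP.
Qed.
HB.instance Definition _ := GRing.isSubmodClosed.Build R N lin_image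
  lin_image_closed.

End KernelImage.

Section PowerSeries.
Variable R : comNzRingType.

Record fps := Fps { coefs : nat -> R }.

HB.instance Definition _ := [isNew for coefs].
HB.instance Definition _ := gen_eqMixin fps.
HB.instance Definition _ := gen_choiceMixin fps.

Implicit Types f g h : fps.

Lemma fpsP f g : (forall n, coefs f n = coefs g n) <-> f = g.
Proof.
split=> [|-> //]; case: f g => [u] [v] /= uv; congr Fps.
exact: functional_extensionality_dep.
Qed.

Definition fps_zero : fps := Fps (fun=> 0).
Definition fps_opp f : fps := Fps (fun n => - coefs f n).
Definition fps_add f g : fps := Fps (fun n => coefs f n + coefs g n).
Definition fps_const (a : R) : fps := Fps (fun n => if n == 0%N then a else 0).
Definition fps_mul f g : fps :=
  Fps (fun n => \sum_(j < n.+1) coefs f j * coefs g (n - j)%N).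
Definition fps_t : fps := Fps (fun n => (n == 1%N)%:R).

Fact fps_addA : associative fps_add.
Proof. by move=> f g h; apply/fpsP => n; exact: addrA. Qed.
Fact fps_addC : commutative fps_add.
Proof. by move=> f g; apply/fpsP => n; exact: addrC. Qed.
Fact fps_add0 : left_id fps_zero fps_add.
Proof. by move=> f; apply/fpsP => n; exact: add0r. Qed.
Fact fps_addN : left_inverse fps_zero fps_opp fps_add.
Proof. by move=> f; apply/fpsP => n; exact: addNr. Qed.
HB.instance Definition _ := GRing.isZmodule.Build fps
  fps_addA fps_addC fps_add0 fps_addN.

Definition fps_trunc N f : {poly R} := \poly_(i < N.+1) coefs f i.

Lemma coef_fps_trunc N f i : (i <= N)%N -> (fps_trunc N f)`_i = coefs f i.
Proof. by move=> leiN; rewrite coef_poly ltnS leiN. Qed.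

Lemma coefs_mul_trunc N f g i : (i <= N)%N ->
  coefs (fps_mul f g) i = (fps_trunc N f * fps_trunc N g)`_i.
Proof.
move=> leiN; rewrite coefM; apply: eq_bigr => j _.
have leji : (j <= i)%N by rewrite -ltnS.
by rewrite !coef_fps_trunc // ?(leq_trans leji) // (leq_trans (leq_subr _ _)).
Qed.

Fact fps_mulC : commutative fps_mul.
Proof.
by move=> f g; apply/fpsP => n; rewrite !(coefs_mul_trunc _ _ (leqnn n)) mulrC.
Qed.

Fact fps_mulA : associative fps_mul.
Proof.
move=> f g h; apply/fpsP => n; set F := fps_trunc n.
transitivity (F f * (F g * F h))`_n.
  rewrite coefM; apply: eq_bigr => j _.
  have lejn : (j <= n)%N by rewrite -ltnS.
  by rewrite -coefs_mul_trunc ?leq_subr // coef_fps_trunc.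
rewrite mulrA coefM; apply: eq_bigr => j _.
have lejn : (j <= n)%N by rewrite -ltnS.
by rewrite -coefs_mul_trunc // coef_fps_trunc ?leq_subr.
Qed.

Fact fps_mul1 : left_id (fps_const 1) fps_mul.
Proof.
move=> f; apply/fpsP => n /=.
by rewrite big_ord_recl /= mul1r subn0 big1 ?addr0 // => i _; rewrite mul0r.
Qed.

Fact fps_mulDl : left_distributive fps_mul +%R.
Proof.
move=> f g h; apply/fpsP => n /=.
by rewrite -big_split; apply: eq_bigr => j _; rewrite /= mulrDl.
Qed.

Fact fps_one_neq0 : fps_const 1 != 0.
Proof. by apply/eqP => /fpsP/(_ 0%N)/eqP /=; rewrite oner_eq0. Qed.

HB.instance Definition _ := GRing.Zmodule_isComNzRing.Build fps
  fps_mulA fps_mulC fps_mul1 fps_mulDl fps_one_neq0.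

Fact fps_const_is_zmod_morphism : zmod_morphism fps_const.
Proof. by move=> a b; apply/fpsP => -[|n] //=; rewrite subr0. Qed.
Fact fps_const_is_monoid_morphism : monoid_morphism fps_const.
Proof.
split=> // a b; apply/fpsP => n /=.
rewrite big_ord_recl /= subn0 big1 ?addr0 => [|i _]; last by rewrite mul0r.
by case: n => //=; rewrite mulr0.
Qed.
HB.instance Definition _ :=
  GRing.isZmodMorphism.Build R fps fps_const fps_const_is_zmod_morphism.
HB.instance Definition _ :=
  GRing.isMonoidMorphism.Build R fps fps_const fps_const_is_monoid_morphism.

Definition fps_unit : pred fps := fun f => `[< exists g, g * f = 1 >].
Definition fps_inv f : fps :=
  match pselect (exists g, g * f = 1) with
  | left ex_g => projT1 (cid ex_g)
  | right _ => f
  end.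

Fact fps_mulVr : {in fps_unit, left_inverse 1 fps_inv *%R}.
Proof.
move=> f /asboolP ex_g; rewrite /fps_inv.
by case: pselect => // ?; case: cid.
Qed.
Fact fps_unitP f g : g * f = 1 -> fps_unit f.
Proof. by move=> gf; apply/asboolP; exists g. Qed.
Fact fps_inv_out : {in [predC fps_unit], fps_inv =1 id}.
Proof.
by move=> f /negP nf; rewrite /fps_inv; case: pselect => // ?; case: nf; exact/asboolP.
Qed.
HB.instance Definition _ := GRing.ComNzRing_hasMulInverse.Build fps
  fps_mulVr fps_unitP fps_inv_out.

End PowerSeries.

Section PowerSeriesDomain.
Variable R : idomainType.

Fact fps_integral (f g : fps R) : f * g = 0 -> (f == 0) || (g == 0).
Proof.
move=> fg0; case: eqVneq => //= f0; case: eqVneq => // g0; exfalso.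
have low (h : fps R) : h != 0 ->
    exists n, coefs h n != 0 /\ forall i, (i < n)%N -> coefs h i = 0.
  move=> h0; have ex_n : exists n, coefs h n != 0.
    apply: contrapT => nex; move/eqP: h0; apply; apply/fpsP => n.
    by apply/eqP; apply: contrapT => /negP hn; apply: nex; exists n.
  case: (ex_minnP ex_n) => n hn minn; exists n; split=> // i ltin.
  apply/eqP; apply: contraTT ltin; rewrite -leqNgt; exact: minn.
have [m [fm lowf]] := low _ f0; have [n [gn lowg]] := low _ g0.
have /fpsP/(_ (m + n)%N)/= := fg0.
have ltm : (m < (m + n).+1)%N by rewrite ltnS leq_addr.
rewrite (bigD1 (Ordinal ltm)) //= addKn big1 ?addr0 => [/eqP|i].
  by rewrite mulf_eq0 (negPf fm) (negPf gn).
rewrite -val_eqE /= neq_ltn => /orP[/lowf-> | ltmi]; first by rewrite mul0r.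
rewrite [X in _ * X]lowg ?mulr0 // ltn_subLR ?ltn_add2r //.
by rewrite -ltnS ltn_ord.
Qed.

HB.instance Definition _ :=
  GRing.ComUnitRing_isIntegral.Build (fps R) fps_integral.

End PowerSeriesDomain.

(* [idealr] excludes the unit ideal, which is needed both as
   an annihilator and as an empty product; an ideal is thus a submodule of the
   regular module. *)
Notation ideal R := (submodClosed R^o).

Section Ideals.
Variable R : idomainType.

Definition ideal_zero_pred : {pred R^o} := fun x => x == 0.
Fact ideal_zero_closed : submod_closed ideal_zero_pred.
Proof.
split=> [|a x y]; rewrite !unfold_in //.
by move=> /eqP-> /eqP->; rewrite scaler0 addr0.
Qed.
HB.instance Definition _ :=
  GRing.isSubmodClosed.Build R R^o ideal_zero_pred ideal_zero_closed.
Definition ideal_zero : ideal R := ideal_zero_pred.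

Definition ideal_one_pred : {pred R^o} := fun=> true.
Fact ideal_one_closed : submod_closed ideal_one_pred.
Proof. by []. Qed.
HB.instance Definition _ :=
  GRing.isSubmodClosed.Build R R^o ideal_one_pred ideal_one_closed.
Definition ideal_one : ideal R := ideal_one_pred.

Definition ideal_mul_pred (I J : ideal R) : {pred R^o} := fun x =>
  `[< exists s : seq (R * R), all (fun u => (u.1 \in I) && (u.2 \in J)) s
        /\ x = \sum_(u <- s) u.1 * u.2 >].
Fact ideal_mul_closed I J : submod_closed (ideal_mul_pred I J).
Proof.
split=> [|a x y]; rewrite !unfold_in.
  by apply/asboolP; exists [::]; rewrite big_nil.
move=> /asboolP[s [sP ->]] /asboolP[r [rP ->]]; apply/asboolP.
exists ([seq (a * u.1, u.2) | u <- s] ++ r); split.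
  rewrite all_cat rP andbT all_map; apply: sub_all sP => u /= /andP[uI ->].
  by rewrite andbT; exact: (@rpredZ _ R^o I a u.1).
rewrite big_cat big_map /=; congr (_ + _).
by rewrite scaler_sumr; apply: eq_bigr => u _; rewrite -mulrA.
Qed.
HB.instance Definition _ I J :=
  GRing.isSubmodClosed.Build R R^o (ideal_mul_pred I J) (ideal_mul_closed I J).
Definition ideal_mul (I J : ideal R) : ideal R := ideal_mul_pred I J.

Definition ideal_exp (I : ideal R) (n : nat) : ideal R :=
  iter n (ideal_mul I) ideal_one.

Definition prime_ideal (p : ideal R) : Prop :=
  idealr_closed (p : {pred R}) /\ prime_idealr_closed (p : {pred R}).

Definition strict_sub (I J : ideal R) : Prop :=
  {subset I <= J} /\ ~ {subset J <= I}.

(* The height of a prime is the supremum of the lengths n of the chains of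
   primes p_0 < ... < p_n ending at it; the height of an ideal is the infimum
   of the heights of the primes containing it (infinite for the unit ideal). *)
Definition prime_chain (n : nat) (c : nat -> ideal R) : Prop :=
  (forall i, (i <= n)%N -> prime_ideal (c i)) /\
  (forall i, (i < n)%N -> strict_sub (c i) (c i.+1)).

Definition height_geq (n : nat) (I : ideal R) : Prop :=
  forall p : ideal R, prime_ideal p -> {subset I <= p} ->
  exists c, prime_chain n c /\ c n =i p.

Definition height_one_prime (p : ideal R) : Prop :=
  [/\ prime_ideal p, height_geq 1 p & ~ height_geq 2 p].

End Ideals.

Section Modules.
Variables (R : idomainType) (M : lmodType R).

Definition fin_gen : Prop :=
  exists n (g : 'I_n -> M), forall m, exists a : 'I_n -> R,
    m = \sum_(i < n) a i *: g i.

Definition torsion : Prop :=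
  forall m : M, exists2 a : R, a != 0 & a *: m = 0.

Definition annihilator_pred : {pred R^o} :=
  fun a => `[< forall m : M, (a : R) *: m = 0 >].
Fact annihilator_closed : submod_closed annihilator_pred.
Proof.
split=> [|a x y]; rewrite !unfold_in; first by apply/asboolP => m; exact: scale0r.
move=> /asboolP xM /asboolP yM; apply/asboolP => m.
by rewrite scalerDl yM addr0 -scalerA xM scaler0.
Qed.
HB.instance Definition _ :=
  GRing.isSubmodClosed.Build R R^o annihilator_pred annihilator_closed.
Definition annihilator : ideal R := annihilator_pred.

Definition pseudo_null : Prop :=
  [/\ fin_gen, torsion & height_geq 2 annihilator].

End Modules.

Definition noetherian (R : idomainType) : Prop :=
  forall I : ideal R, fin_gen (submodule I).

(* S is the valuation ring of a normalized discrete valuation of K; the value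
   of v at 0 is irrelevant. *)
Definition discrete_valuation_ring (K : fieldType) (S : set K) : Prop :=
  exists v : K -> int,
    [/\ forall k, exists2 x, x != 0 & v x = k,
        forall x y, x != 0 -> y != 0 -> v (x * y) = v x + v y,
        forall x y, x != 0 -> y != 0 -> x + y != 0 ->
          Num.min (v x) (v y) <= v (x + y)
      & S = [set x | x = 0 \/ 0 <= v x]].

Section Krull.
Variable R : idomainType.

Definition localization (p : ideal R) : set {fraction R} :=
  [set z | exists x y : R, y \notin p /\ z = tofrac x / tofrac y].

Definition unit_in_localization (p : ideal R) (x : R) : Prop :=
  exists2 z, localization p z & tofrac x * z = 1.

Definition krull : Prop :=
  [/\ range (@tofrac R) = \bigcap_(p in @height_one_prime R) localization p,
      forall p, height_one_prime p -> discrete_valuation_ring (localization p)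
    & forall x : R, x != 0 ->
        finite_set [set p | height_one_prime p /\ ~ unit_in_localization p x]].

End Krull.

Section CharacteristicIdeal.
Variable R : idomainType.

Definition pseudo_isomorphism (M N : lmodType R) (f : {linear M -> N}) : Prop :=
  pseudo_null (submodule (lin_kernel f)) /\
  pseudo_null (quotmodule (lin_image f)).

(* The primes need not be distinct. *)
Record prime_powers := PrimePowers {
  pp_size : nat;
  pp_prime : 'I_pp_size -> ideal R;
  pp_exp : 'I_pp_size -> nat;
  pp_height_one : forall i, height_one_prime (pp_prime i);
  pp_exp_gt0 : forall i, (0 < pp_exp i)%N
}.

Definition elementary_module (d : prime_powers) : lmodType R :=
  direct_sum (fun i => quotmodule (ideal_exp (pp_prime i) (@pp_exp d i))).

Definition prime_powers_prod (d : prime_powers) : ideal R :=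
  \big[@ideal_mul R/ideal_one R]_(i < pp_size d)
     ideal_exp (pp_prime i) (pp_exp i).

Definition pseudo_isomorphic (M N : lmodType R) : Prop :=
  exists f : {linear M -> N}, pseudo_isomorphism f.

(* A finitely generated torsion module M over a noetherian Krull domain is
   pseudo-isomorphic to some [elementary_module d], and d is unique up to
   order; the last case of the match is then void. *)
Definition char_ideal (M : lmodType R) : ideal R :=
  if `[< torsion M >] then
    match pselect (exists d, pseudo_isomorphic M (elementary_module d)) with
    | left ex_d => prime_powers_prod (projT1 (cid ex_d))
    | right _ => ideal_zero R
    end
  else ideal_zero R.

End CharacteristicIdeal.

Section TKernelCokernel.
Variables (R : idomainType) (M : lmodType (fps R)).

Local Notation rM := (restrict_scalars M (@fps_const R)).

Definition t_torsion_pred : {pred rM} := fun m => fps_t R *: (m : M) == 0.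
Fact t_torsion_closed : submod_closed t_torsion_pred.
Proof.
split=> [|a x y]; rewrite !unfold_in ?scaler0 //.
move=> /eqP tx /eqP ty; rewrite scalerDr ty addr0.
by rewrite [_ *: x]/(fps_const a *: (x : M)) scalerA mulrC -scalerA tx scaler0.
Qed.
HB.instance Definition _ :=
  GRing.isSubmodClosed.Build R rM t_torsion_pred t_torsion_closed.
Definition t_torsion : lmodType R := submodule t_torsion_pred.

Definition t_multiples_pred : {pred rM} :=
  fun m => `[< exists m' : M, (m : M) = fps_t R *: m' >].
Fact t_multiples_closed : submod_closed t_multiples_pred.
Proof.
split=> [|a x y]; rewrite !unfold_in.
  by apply/asboolP; exists 0; rewrite scaler0.
move=> /asboolP[u xu] /asboolP[v yv]; apply/asboolP.
exists (fps_const a *: u + v); rewrite scalerDr scalerA mulrC -scalerA.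
by rewrite -xu -yv.
Qed.
HB.instance Definition _ :=
  GRing.isSubmodClosed.Build R rM t_multiples_pred t_multiples_closed.
Definition mod_t : lmodType R := quotmodule t_multiples_pred.

End TKernelCokernel.

(* Main.v *)
(* Fix a height one prime p of A and let l be the length of the localization at p.
   Multiplication by t identifies l(M/tM) - l(M_t) with the same difference for tM,
   hence with l(t^n M/t^(n+1) M) for n so large that t is injective on t^n M. The
   characteristic ideals therefore agree iff every t^n M/t^(n+1) M vanishes at p.

   If it does, Cayley-Hamilton gives D in B with constant term a power of some s not
   in p and D t^n M = 0; since every height one prime Q of B containing the annihilator
   of M has its constant terms in some height one prime p of A, neither D nor t is in Q,
   and M is pseudo-null. Conversely, if M is pseudo-null, a prime Q of B containing the
   annihilator of M, maximal among the ideals avoiding all t^k s with s(0) not in p,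
   cannot have height one; a nonzero prime strictly inside Q then contradicts a
   length computation in a quotient of B, which amounts to (p, t) having height two.
   So some t^k s annihilates M, and t^n M/t^(n+1) M vanishes at p.

   No localization is formed: lengths at p are suprema of lengths of chains of
   submodules each of which grows outside the p-saturation of the previous one. *)
From HB Require Import structures.
Require Import Defs.
From mathcomp Require Import all_boot all_order all_algebra.
From mathcomp Require Import boolp classical_sets cardinality.

Set Implicit Arguments.
Unset Strict Implicit.
Unset Printing Implicit Defensive.

Import Order.TTheory GRing.Theory Num.Theory.

Local Open Scope classical_set_scope.
Local Open Scope ring_scope.

(** * Submodules as sets, spans and the noetherian condition *)

Section SubmoduleSets.
Variable R : idomainType.
Implicit Types (V W : lmodType R).

(** The hypothesis on M/tM provides an f in B that annihilates M and has f(0) nonzero. This f makes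
    M_t torsion over A, keeps t out of every height one prime containing the annihilator of M, and
    its constant term is what the divisions modulo f rely on. The Euler characteristic argument runs
    twice: on M, and on B modulo Q' + hB, where Q' is the smaller prime and h is in Q but not in Q'.
    In the second case the kernel and the cokernel of t have equal length at p, so the stable
    quotient vanishes at p and some t^n s lies in Q' + hB. Hence it is set up for an endomorphism of
    a module V modulo a submodule Z. By default [char_ideal] is the zero ideal when no
    pseudo-isomorphism to an elementary module exists, so the structure theorem has to be proved
    before equality of characteristic ideals says anything about lengths. Lengths are natural
    numbers with a default value when infinite; differences of lengths therefore appear as
    identities between sums, under finiteness assumptions. *)

Definition submod_set V (X : set V) :=
  X 0 /\ forall a x y, X x -> X y -> X (a *: x + y).

(** The closure proof is carried as an argument so that the instance below can be inferred from the
    term. This turns a set back into a [submodClosed] predicate, in particular into an ideal. *)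
Definition submod_set_pred V (X : set V) (_ : submod_set X) : {pred V} :=
  fun x => `[< X x >].

Fact submod_set_pred_closed V (X : set V) (HX : submod_set X) :
  submod_closed (submod_set_pred HX).
Proof.
case: (HX) => X0 XD; split=> [|a x y]; rewrite !unfold_in; first exact/asboolP.
by move=> /asboolP Xx /asboolP Xy; apply/asboolP/XD.
Qed.
HB.instance Definition _ V (X : set V) (HX : submod_set X) :=
  GRing.isSubmodClosed.Build R V (submod_set_pred HX) (submod_set_pred_closed HX).

Lemma in_submod_set V (X : set V) (HX : submod_set X) x :
  (x \in submod_set_pred HX) <-> X x.
Proof. by rewrite unfold_in; split=> /asboolP. Qed.

Section Closure.
Variables (V : lmodType R) (X : set V).
Hypothesis HX : submod_set X.

Lemma submod_set0 : X 0. Proof. by case: HX. Qed.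
Lemma submod_setD x y : X x -> X y -> X (x + y).
Proof. by case: HX => _ XD Xx Xy; rewrite -[x]scale1r; exact: XD. Qed.
Lemma submod_setZ a x : X x -> X (a *: x).
Proof. by case: HX => X0 XD Xx; rewrite -[_ *: _]addr0; exact: XD. Qed.
Lemma submod_setN x : X x -> X (- x).
Proof. by rewrite -scaleN1r; exact: submod_setZ. Qed.
Lemma submod_setB x y : X x -> X y -> X (x - y).
Proof. by move=> Xx Xy; apply: submod_setD => //; exact: submod_setN. Qed.
Lemma submod_set_sum (I : Type) (r : seq I) (P : pred I) (F : I -> V) :
  (forall i, P i -> X (F i)) -> X (\sum_(i <- r | P i) F i).
Proof. by move=> XF; elim/big_ind: _ => //; [exact: submod_set0|exact: submod_setD]. Qed.
Lemma submod_setDl x y : X x -> X (x + y) <-> X y.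
Proof.
move=> Xx; split=> [Xxy|]; last exact: submod_setD.
by rewrite -(addKr x y); apply: submod_setD => //; exact: submod_setN.
Qed.

End Closure.

Lemma submod_set_mem V (S : submodClosed V) : submod_set [set x | x \in S].
Proof. by split=> [|a x y] /=; [exact: rpred0|move=> xS yS; rewrite rpredD ?rpredZ]. Qed.

Lemma submod_setT V : submod_set (@setT V). Proof. by []. Qed.
Lemma submod_set1 V : submod_set [set (0 : V)].
Proof. by split=> // a x y /= -> ->; rewrite scaler0 addr0. Qed.
Lemma submod_setI V (X Y : set V) :
  submod_set X -> submod_set Y -> submod_set (X `&` Y).
Proof.
move=> [X0 XD] [Y0 YD]; split=> // a x y [Xx Yx] [Xy Yy].
by split; [exact: XD|exact: YD].
Qed.

Definition addset V (X Y : set V) : set V :=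
  [set z | exists x y, [/\ X x, Y y & z = x + y]].

Lemma submod_addset V (X Y : set V) :
  submod_set X -> submod_set Y -> submod_set (addset X Y).
Proof.
move=> [X0 XD] [Y0 YD]; split; first by exists 0, 0; rewrite addr0.
move=> a _ _ [x [y [Xx Yy ->]]] [x' [y' [Xx' Yy' ->]]].
exists (a *: x + x'), (a *: y + y'); split; [exact: XD|exact: YD|].
by rewrite scalerDr addrACA.
Qed.

Lemma addset_subl V (X Y : set V) : submod_set Y -> X `<=` addset X Y.
Proof. by move=> [Y0 _] x Xx; exists x, 0; rewrite addr0. Qed.
Lemma addset_subr V (X Y : set V) : submod_set X -> Y `<=` addset X Y.
Proof. by move=> [X0 _] y Yy; exists 0, y; rewrite add0r. Qed.
Lemma addset_sub V (X Y Z : set V) :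
  submod_set Z -> X `<=` Z -> Y `<=` Z -> addset X Y `<=` Z.
Proof.
move=> HZ XZ YZ _ [x [y [Xx Yy ->]]].
by apply: submod_setD => //; [exact: XZ|exact: YZ].
Qed.

Definition line V (x : V) : set V := [set y | exists a, y = a *: x].
Lemma submod_line V (x : V) : submod_set (line x).
Proof.
split=> [|a _ _ [b ->] [c ->]]; first by exists 0; rewrite scale0r.
by exists (a * b + c); rewrite scalerDl scalerA.
Qed.
Lemma line_id V (x : V) : line x x.
Proof. by exists 1; rewrite scale1r. Qed.

Lemma submod_preimage V W (f : V -> W) (Y : set W) :
  linear f -> submod_set Y -> submod_set (f @^-1` Y).
Proof.
move=> lf [Y0 YD]; have f0 : f 0 = 0.
  by have := lf (-1) 0 0; rewrite scaler0 addr0 scaleN1r addNr.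
by split=> [|a x y]; rewrite /preimage /= ?f0 // lf; exact: YD.
Qed.
Lemma submod_image V W (f : V -> W) (X : set V) :
  linear f -> submod_set X -> submod_set (f @` X).
Proof.
move=> lf [X0 XD]; have f0 : f 0 = 0.
  by have := lf (-1) 0 0; rewrite scaler0 addr0 scaleN1r addNr.
split=> [|a _ _ [x Xx <-] [y Xy <-]]; first by exists 0.
by exists (a *: x + y); [exact: XD|rewrite lf].
Qed.

Definition span V (s : seq V) : set V :=
  [set x | exists c : nat -> R, x = \sum_(i < size s) c i *: s`_i].

Lemma span_nil V (x : V) : span [::] x <-> x = 0.
Proof.
split=> [[c ->]|->]; first by rewrite big_ord0.
by exists (fun=> 0); rewrite big_ord0.
Qed.

Lemma span_cons V (g : V) s x :
  span (g :: s) x <-> exists a y, span s y /\ x = a *: g + y.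
Proof.
split=> [[c ->]|[a [_ [[c ->] ->]]]].
  rewrite big_ord_recl /=; exists (c 0%N), (\sum_(i < size s) c i.+1 *: s`_i).
  by split=> //; exists (fun n => c n.+1).
by exists (fun n => if n is k.+1 then c k else a); rewrite big_ord_recl.
Qed.

Lemma submod_span V (s : seq V) : submod_set (span s).
Proof.
split=> [|a _ _ [c ->] [d ->]].
  by exists (fun=> 0); rewrite big1 // => i _; rewrite scale0r.
exists (fun n => a * c n + d n); rewrite scaler_sumr -big_split /=.
by apply: eq_bigr => i _; rewrite scalerDl scalerA.
Qed.

Lemma mem_span V (s : seq V) x : x \in s -> span s x.
Proof.
elim: s => // g s IH; rewrite inE span_cons => /orP[/eqP->|/IH sx].
  by exists 1, 0; rewrite scale1r addr0; split=> //; exact: submod_set0 (submod_span s).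
by exists 0, x; rewrite scale0r add0r.
Qed.

Lemma span_sub V (s : seq V) (X : set V) :
  submod_set X -> {in s, forall x, X x} -> span s `<=` X.
Proof.
move=> HX sX _ [c ->]; apply: submod_set_sum => // i _.
by apply: submod_setZ => //; apply: sX; exact: mem_nth.
Qed.

Lemma span_mono V (s s' : seq V) : {subset s <= s'} -> span s `<=` span s'.
Proof.
move=> ss'; apply: span_sub; first exact: submod_span.
by move=> x /ss'; exact: mem_span.
Qed.

Definition fin_span V (X : set V) := exists s, forall x, X x <-> span s x.

Definition noeth V := forall X : set V, submod_set X -> fin_span X.

Lemma fin_genP V : fin_gen V <-> fin_span (@setT V).
Proof.
split=> [[n [g gV]]|[s sV]]; last first.
  exists (size s), (fun i => s`_i) => m.
  by case: (sV m) => /(_ I)[c ->] _; exists (fun i => c i).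
exists [seq g i | i <- enum 'I_n] => x; split=> // _.
have [a ->] := gV x; apply: submod_set_sum => [|i _]; first exact: submod_span.
apply: submod_setZ; first exact: submod_span.
by apply/mem_span/mapP; exists i; rewrite ?mem_enum.
Qed.

Lemma fin_gen_submoduleP V (S : submodClosed V) :
  fin_gen (submodule S) <-> fin_span [set x | x \in S].
Proof.
split=> [[n [g gS]]|[s sS]].
  exists [seq val (g i) | i <- enum 'I_n] => x; split=> [xS|].
    have [a] := gS (Sub x xS); move/(congr1 val); rewrite SubK linear_sum => ->.
    apply: submod_set_sum => [|i _]; first exact: submod_span.
    rewrite linearZ; apply: submod_setZ; first exact: submod_span.
    by apply/mem_span/mapP; exists i; rewrite ?mem_enum.
  apply: span_sub; first exact: submod_set_mem.
  by move=> _ /mapP[i _ ->]; exact: valP.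
have sS' (i : nat) : s`_i \in S.
  case: (ltnP i (size s)) => si; last by rewrite nth_default ?rpred0.
  by apply/(sS _)/mem_span; exact: mem_nth.
exists (size s), (fun i : 'I_(size s) => Sub s`_i (sS' i)) => m.
have [/(_ (valP m))[c mE] _] := sS (val m).
exists (fun i => c i); apply: val_inj; rewrite mE linear_sum.
by apply: eq_bigr => i _; rewrite linearZ.
Qed.

Lemma noeth_ring : noetherian R -> noeth R^o.
Proof.
move=> nR X HX; pose I : ideal R := submod_set_pred HX.
have [s sI] := (fin_gen_submoduleP I).1 (nR I).
by exists s => x; rewrite -sI /=; split=> /in_submod_set.
Qed.

(** Induction on the generators. The coefficients of g occurring in elements of X form an ideal I;
    lifts to X of generators of I, together with generators of the intersection of X with [span s],
    generate X. *)
Lemma noeth_span V (s : seq V) (X : set V) : noeth R^o ->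
  submod_set X -> X `<=` span s -> fin_span X.
Proof.
move=> nR; elim: s X => [|g s IH] X HX Xs.
  exists [::] => x; split=> [/Xs //|/span_nil ->]; exact: submod_set0.
pose I : set R^o := [set r | exists2 y, span s y & X ((r : R) *: g + y)].
have HI : submod_set I.
  split=> [|a r r' [y sy Xy] [y' sy' Xy']].
    by exists 0; [exact: submod_set0 (submod_span s)|rewrite scale0r addr0; exact: submod_set0].
  exists (a *: y + y'); first by case: (submod_span s) => _; exact.
  rewrite scalerDl addrACA -[(_ *: r) *: g]/((a * r) *: g) -scalerA -scalerDr.
  by case: HX => _; exact.
have [rs Irs] := nR I HI.
have [s1 Xs1] := IH (X `&` span s) (submod_setI HX (submod_span s)) (@subIsetr _ _ _).
have /choice[y Hy] : forall r, exists y, I r -> span s y /\ X ((r : R) *: g + y).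
  move=> r; case: (pselect (I r)) => [[y ? ?]|nI]; first by exists y.
  by exists 0.
pose s2 := [seq (r : R) *: g + y r | r <- rs].
have s2X : {in s2, forall x, X x}.
  by move=> _ /mapP[r rrs ->]; apply: (Hy r _).2; apply/Irs/mem_span.
have s1X : {in s1, forall x, X x} by move=> x /mem_span /Xs1[].
exists (s2 ++ s1) => x; split=> [Xx|]; last first.
  by apply: span_sub => // z; rewrite mem_cat => /orP[/s2X|/s1X].
have /span_cons[a [z [sz xE]]] := Xs x Xx.
have /Irs[c aE] : I a by exists z => //; rewrite -xE.
pose w := \sum_(i < size rs) c i *: ((rs`_i : R) *: g + y rs`_i).
have s2w : span s2 w.
  exists c; rewrite size_map; apply: eq_bigr => i _.
  by rewrite (nth_map 0).
have Xw : X w by apply: (span_sub HX s2X).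
rewrite -(subrK w x); apply: submod_setD; first exact: submod_span.
  apply: (@span_mono _ s1) => [z' zs1|]; first by rewrite mem_cat zs1 orbT.
  apply/Xs1; split; first exact: submod_setB.
  have -> : x - w = z - \sum_(i < size rs) c i *: y rs`_i.
    rewrite xE aE /w; under [X in _ - X]eq_bigr do rewrite scalerDr scalerA.
    by rewrite big_split /= scaler_suml opprD addrACA subrr add0r.
  apply: submod_setB => //; first exact: submod_span.
  apply: submod_set_sum => [|i _]; first exact: submod_span.
  apply: submod_setZ; first exact: submod_span.
  by apply: (Hy _ _).1; apply/Irs/mem_span/mem_nth.
by apply: (@span_mono _ s2) => // z' zs2; rewrite mem_cat zs2.
Qed.

Lemma noeth_module V : noetherian R -> fin_gen V -> noeth V.
Proof.
move=> /noeth_ring nR /fin_genP[s sV] X HX.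
by apply: (@noeth_span V s) => // x _; apply/sV.
Qed.

(** Without a maximal member above X0, choice gives a strictly increasing sequence. Its union is
    finitely generated, so the generators already lie in one term, which contradicts the next
    step. *)
Lemma noeth_max V (P : set V -> Prop) (X0 : set V) : noeth V ->
  (forall X, P X -> submod_set X) -> P X0 ->
  exists X, [/\ P X, X0 `<=` X & forall Y, P Y -> X `<=` Y -> Y `<=` X].
Proof.
move=> nV Psub PX0; apply: contrapT => nmax.
pose T := {X : set V | P X /\ X0 `<=` X}.
have step (X : T) : exists Y : T, sval X `<=` sval Y /\ ~ sval Y `<=` sval X.
  case: X => X [PX X0X] /=; apply: contrapT => nY; apply: nmax; exists X; split=> //.
  move=> Y PY XY; apply: contrapT => nYX; apply: nY.
  by exists (exist _ Y (conj PY (subset_trans X0X XY))).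
have [f Hf] := choice step.
pose c := fix c n := if n is k.+1 then f (c k) else exist _ X0 (conj PX0 (@subset_refl _ X0)).
have cmono m n : (m <= n)%N -> sval (c m) `<=` sval (c n).
  elim: n => [|n IH]; first by rewrite leqn0 => /eqP->.
  rewrite leq_eqVlt => /orP[/eqP->//|]; rewrite ltnS => /IH mn.
  exact: subset_trans mn (Hf _).1.
pose U : set V := [set x | exists n, sval (c n) x].
have Hc n : submod_set (sval (c n)) by apply: Psub; case: (c n) => ? [].
have HU : submod_set U.
  split; first by exists 0%N; exact: submod_set0 (Hc 0%N).
  move=> a x y [m mx] [n ny]; exists (maxn m n); have [_] := Hc (maxn m n).
  by apply; [apply: cmono mx; rewrite leq_maxl|apply: cmono ny; rewrite leq_maxr].
have [s sU] := nV U HU.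
have [n sn] : exists n, {in s, forall x, sval (c n) x}.
  have : {in s, forall x, U x} by move=> x xs; apply/sU/mem_span.
  elim: s {sU} => [|g s IH] sU; first by exists 0%N.
  have [n gn] := sU g (mem_head _ _).
  have [|m sm] := IH; first by move=> x xs; apply: sU; rewrite inE xs orbT.
  exists (maxn n m) => x; rewrite inE => /orP[/eqP->|/sm].
    by apply: cmono gn; rewrite leq_maxl.
  by apply: cmono; rewrite leq_maxr.
apply: (Hf (c n)).2 => x xS; apply: (span_sub (Hc n) sn); apply/sU.
by exists n.+1.
Qed.

End SubmoduleSets.

(** * Prime ideals, height one and saturation at a prime *)

Section Primes.
Variable R : idomainType.
Implicit Types (p q I J : ideal R) (V : lmodType R).

Lemma ideal_mull I a x : x \in I -> a * x \in I.
Proof. exact: (@rpredZ _ R^o I a x). Qed.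

Lemma prime_ideal1 p : prime_ideal p -> 1 \notin p.
Proof. by case=> -[]. Qed.

Lemma prime_idealM p x y : prime_ideal p -> x * y \in p -> x \notin p -> y \in p.
Proof. by case=> _ pM /pM /orP[->//|]. Qed.

Lemma prime_ideal_notM p x y :
  prime_ideal p -> x \notin p -> y \notin p -> x * y \notin p.
Proof. by move=> Hp xp; apply: contra => /prime_idealM; exact. Qed.

Lemma prime_ideal_notX p x n : prime_ideal p -> x \notin p -> x ^+ n \notin p.
Proof.
move=> Hp xp; elim: n => [|n IH]; first by rewrite expr0; exact: prime_ideal1.
by rewrite exprS; exact: prime_ideal_notM.
Qed.

Lemma prime_idealI p : 1 \notin p ->
  (forall x y, x * y \in p -> x \notin p -> y \notin p -> False) -> prime_ideal p.
Proof.
move=> p1 pM; split; first split=> //; first exact: (@rpred0 R^o p).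
  by move=> a u v up vp; apply: (@rpredD R^o p) => //; exact: ideal_mull.
move=> x y xy; case: (boolP (x \in p)) => //= xp; case: (boolP (y \in p)) => // yp.
by case: (pM x y).
Qed.

Lemma prime_ideal_zero : prime_ideal (ideal_zero R).
Proof.
apply: prime_idealI => [|x y]; rewrite !unfold_in ?oner_eq0 //.
by rewrite mulf_eq0 => /orP[->|->].
Qed.

Lemma strict_sub_notin I J : strict_sub I J -> exists2 x, x \in J & x \notin I.
Proof.
move=> [_ nJI]; apply: contrapT => nx; apply: nJI => x xJ.
by apply: contrapT => /negP xI; apply: nx; exists x.
Qed.

Lemma height_one_neq0 p : height_one_prime p -> exists2 x, x \in p & x != 0.
Proof.
move=> [Hp h1 _]; have [|c [[_ c01] c1]] := h1 p Hp; first by [].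
have [x xc1 xc0] := strict_sub_notin (c01 0%N isT).
exists x; first by rewrite -c1.
by apply: contraNneq xc0 => ->; exact: (@rpred0 R^o (c 0%N)).
Qed.

Lemma height_geq1 p : prime_ideal p -> (exists2 x, x \in p & x != 0) -> height_geq 1 p.
Proof.
move=> Hp [x xp x0] q Hq pq; exists (fun i => if i == 0%N then ideal_zero R else q).
split=> //; split=> [[|i] _ //=|[|//] _]; first exact: prime_ideal_zero.
split=> [y /=|/(_ x (pq _ xp))]; first by rewrite unfold_in => /eqP->; exact: (@rpred0 R^o q).
by rewrite unfold_in (negPf x0).
Qed.

(** If p were not contained in q, then 0, q, p' would be a chain of length two below every prime p'
    containing p, and p would have height at least 2. *)
Lemma height_one_min p q : height_one_prime p -> prime_ideal q ->
  (exists2 x, x \in q & x != 0) -> {subset q <= p} -> {subset p <= q}.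
Proof.
move=> [Hp _ nh2] Hq [x xq x0] qp y yp; apply: contrapT => /negP yq; apply: nh2.
move=> p' Hp' pp'.
exists (fun i => if i == 0%N then ideal_zero R else if i == 1%N then q else p').
split=> //; split=> [[|[|i]] _ //=|[|[|//]] _ /=]; first exact: prime_ideal_zero.
  split=> [z /=|/(_ x xq)]; last by rewrite unfold_in (negPf x0).
  by rewrite unfold_in => /eqP->; exact: (@rpred0 R^o q).
split=> [z /qp /pp' //|/(_ y (pp' _ yp))]; exact/negP.
Qed.

Lemma not_height_one p : prime_ideal p -> (exists2 x, x \in p & x != 0) ->
  ~ height_one_prime p ->
  forall q, prime_ideal q -> {subset p <= q} -> exists c, prime_chain 2 c /\ c 2%N =i q.
Proof.
move=> Hp p0 np q Hq pq; apply: contrapT => nc; apply: np; split=> //.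
  exact: height_geq1.
by move=> /(_ q Hq pq).
Qed.

Lemma prime_between p : prime_ideal p -> (exists2 x, x \in p & x != 0) ->
  ~ height_one_prime p ->
  exists q, [/\ prime_ideal q, exists2 x, x \in q & x != 0, {subset q <= p} &
    exists2 h, h \in p & h \notin q].
Proof.
move=> Hp p0 np; have [//|c [[pc sc] c2]] := not_height_one Hp p0 np Hp.
exists (c 1%N); split; first exact: pc.
- have [x xc1 xc0] := strict_sub_notin (sc 0%N isT); exists x => //.
  by apply: contraNneq xc0 => ->; exact: (@rpred0 R^o (c 0%N)).
- by move=> x /(sc 1%N isT).1; rewrite c2.
- by have [x xc2 xc1] := strict_sub_notin (sc 1%N isT); exists x; rewrite -?c2.
Qed.

(** The elements of V whose image in the localization of V at p lies in that of X. Inclusion of X in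
    [sat p Y] thus means inclusion of the localizations at p. *)
Definition sat p V (X : set V) : set V := [set x | exists2 s, s \notin p & X (s *: x)].

Section Saturation.
Variables (p : ideal R) (V : lmodType R).
Hypothesis Hp : prime_ideal p.
Implicit Types X Y : set V.

Lemma sub_sat X : X `<=` sat p X.
Proof. by move=> x Xx; exists 1; rewrite ?scale1r //; exact: prime_ideal1. Qed.

Lemma sat_mono X Y : X `<=` Y -> sat p X `<=` sat p Y.
Proof. by move=> XY x [s sp /XY Yx]; exists s. Qed.

(** A common denominator: the product of those of the generators. *)
Lemma sat_span X (s : seq V) : submod_set X -> span s `<=` sat p X ->
  exists2 u, u \notin p & forall x, span s x -> X (u *: x).
Proof.
move=> HX; elim: s => [|g s IH] sX.
  exists 1 => [|x /span_nil->]; first exact: prime_ideal1.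
  by rewrite scaler0; exact: submod_set0.
have [|u up uX] := IH.
  by apply: subset_trans sX; apply: span_mono => x xs; rewrite inE xs orbT.
have [u' u'p u'X] := sX g (mem_span (mem_head _ _)).
exists (u * u') => [|_ /span_cons[a [y [sy ->]]]]; first exact: prime_ideal_notM.
rewrite scalerDr; apply: submod_setD => //.
  by rewrite scalerA mulrAC -scalerA; apply: submod_setZ.
by rewrite mulrC -scalerA; apply: submod_setZ => //; exact: uX.
Qed.

End Saturation.

Lemma ann_neq0 V : fin_gen V -> torsion V -> exists2 a : R, a != 0 & forall x : V, a *: x = 0.
Proof.
move=> /fin_genP[s sV] tV.
suff [a a0 aV] : exists2 a : R, a != 0 & forall x : V, span s x -> a *: x = 0.
  by exists a => // x; apply/aV/sV.
elim: {sV}s => [|g s [a a0 IH]].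
  by exists 1; rewrite ?oner_eq0 // => x /span_nil->; rewrite scaler0.
have [b b0 bg] := tV g; exists (a * b); first by rewrite mulf_neq0.
move=> _ /span_cons[c [y [sy ->]]]; rewrite scalerDr scalerA mulrAC -(scalerA (a * c)) bg scaler0 add0r.
by rewrite mulrC -scalerA IH // scaler0.
Qed.

(** The bridge from annihilators to localizations. For the converse, a prime containing the
    annihilator is nonzero by torsion, and it cannot have height one: a common denominator for the
    generators would be in the annihilator but outside the prime. *)
Lemma pseudo_nullP V : pseudo_null V <->
  [/\ fin_gen V, torsion V
    & forall q, height_one_prime q -> forall x : V, sat q [set 0] x].
Proof.
split=> [[fV tV hV]|[fV tV nV]]; split=> //.
  move=> q [Hq _ nh2] x; have : ~ {subset annihilator V <= q}.
    by move=> Vq; apply: nh2 => p Hp qp; apply: hV => // y /Vq /qp.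
  move=> nVq; apply: contrapT => nx; apply: nVq => a; rewrite unfold_in => /asboolP aV.
  by apply: contrapT => /negP aq; apply: nx; exists a => //=; exact: aV.
move=> p Hp Vp; have [a a0 aV] := ann_neq0 fV tV.
have p0 : exists2 x, x \in p & x != 0.
  by exists a => //; apply: Vp; rewrite unfold_in; exact/asboolP.
apply: (not_height_one Hp p0) => // hp; have [s sV] := (fin_genP V).1 fV.
have [|u up uV] := @sat_span p V Hp [set 0] s (@submod_set1 _ V).
  by move=> x _; exact: nV.
move/negP: up; apply; apply: Vp; rewrite unfold_in; apply/asboolP => x.
by apply: uV; apply/sV.
Qed.

End Primes.

(** * Length at a prime *)

Section Length.
Variables (R : idomainType) (p : ideal R).
Hypothesis Hp : prime_ideal p.
Implicit Types V W : lmodType R.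

Fixpoint lgeq V (n : nat) (Y X : set V) : Prop :=
  if n is m.+1 then
    exists Z, [/\ submod_set Z, Y `<=` Z, Z `<=` X,
      exists2 x, Z x & ~ sat p Y x & lgeq m Z X]
  else True.

Definition finlen V (Y X : set V) := exists n, ~ lgeq n Y X.

(** When chains of every length exist, the set is empty and the default 0 is returned; the value is
    informative only under [finlen]. *)
Definition len V (Y X : set V) : nat :=
  xget 0%N [set n | forall m, lgeq m Y X <-> (m <= n)%N].

Section Basics.
Variable V : lmodType R.
Implicit Types X Y Z : set V.

Lemma lgeq_monor n Y X X' : X `<=` X' -> lgeq n Y X -> lgeq n Y X'.
Proof.
move=> XX'; elim: n Y => //= n IH Y [Z [HZ YZ ZX xZ nZ]].
by exists Z; split=> //; [exact: subset_trans XX'|exact: IH].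
Qed.

Lemma lgeq_monol n Y Y' X : Y' `<=` Y -> lgeq n Y X -> lgeq n Y' X.
Proof.
case: n => //= n YY' [Z [HZ YZ ZX [x Zx xY] nZ]].
exists Z; split=> //; first exact: subset_trans YZ.
by exists x => // /(sat_mono YY').
Qed.

Lemma lgeq_leq m n Y X : (m <= n)%N -> lgeq n Y X -> lgeq m Y X.
Proof.
elim: n => [|n IH]; first by rewrite leqn0 => /eqP->.
rewrite leq_eqVlt => /orP[/eqP->//|]; rewrite ltnS => mn [Z [_ YZ _ _ nZ]].
exact/(IH mn)/(lgeq_monol YZ).
Qed.

Lemma lgeq_cat n m Y Z X : Y `<=` Z -> Z `<=` X ->
  lgeq n Y Z -> lgeq m Z X -> lgeq (n + m) Y X.
Proof.
move=> + ZX + mZ; elim: n Y => [|n IH] Y YZ /=; first by move=> _; exact: lgeq_monol mZ.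
move=> [Z1 [HZ1 YZ1 Z1Z xZ1 nZ1]]; exists Z1; split=> //; last exact: IH.
exact: subset_trans ZX.
Qed.

(* If neither [Y1 /\ Z] over [Y /\ Z] nor [Y1 + Z] over [Y + Z] grows at p, then
   Y1 does not grow over Y at p, by the modular law. *)
Lemma lgeq_split k Y Z X : submod_set Y -> submod_set Z -> lgeq k Y X ->
  exists n m, [/\ (k <= n + m)%N, lgeq n (Y `&` Z) (X `&` Z)
    & lgeq m (addset Y Z) (addset X Z)].
Proof.
move=> + HZ; elim: k Y => [|k IH] Y HY /=; first by exists 0%N, 0%N.
move=> [Y1 [HY1 YY1 Y1X [x Y1x xY] /(IH _ HY1)[n [m [knm nI mD]]]]].
have YY1Z : addset Y Z `<=` addset Y1 Z.
  apply: addset_sub; [exact: submod_addset|exact: subset_trans (addset_subl HZ)|].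
  exact: addset_subr.
have YY1I : Y `&` Z `<=` Y1 `&` Z by move=> z [/YY1].
have [Y1I|nY1I] := pselect (Y1 `&` Z `<=` sat p (Y `&` Z)); last first.
  exists n.+1, m; split; [by rewrite addSn|exists (Y1 `&` Z); split=> //|].
  - exact: submod_setI.
  - by move=> z [/Y1X].
  - apply: contrapT => nz; apply: nY1I => z Y1z; apply: contrapT => nz'.
    by apply: nz; exists z.
  - exact: lgeq_monol mD.
exists n, m.+1; split; [by rewrite addnS|exact: lgeq_monol nI|].
exists (addset Y1 Z); split=> //; first exact: submod_addset.
  by move=> _ [y [z [/Y1X Xy Zz ->]]]; exists y, z.
exists x; first exact: addset_subl.
move=> [s sp [y [z [Yy Zz sx]]]]; apply: xY.
have zE : z = s *: x - y by rewrite sx addrC addKr.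
have [] := Y1I z.
  split=> //; rewrite zE; apply: submod_setB => //; last exact: YY1.
  exact: submod_setZ.
move=> u up [Yuz _]; exists (u * s); first exact: prime_ideal_notM.
rewrite -scalerA sx scalerDr; apply: submod_setD => //.
exact: submod_setZ.
Qed.

Lemma lenP Y X : finlen Y X -> forall m, lgeq m Y X <-> (m <= len Y X)%N.
Proof.
move=> [N nN]; rewrite /len; case: xgetP => [n _ //|].
have ex : exists n, `[< ~ lgeq n Y X >] by exists N; exact/asboolP.
case: (ex_minnP ex) => n /asboolP nn minn nE; exfalso; apply: (nE n.-1) => m /=.
case: n nn minn {nE} => [[] //|n] nn minn; split=> [mX|mn].
  rewrite leqNgt; apply/negP => nm; exact/nn/(lgeq_leq nm).
apply: contrapT => nX; have := minn m; rewrite ltnNge mn => nm.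
by have /nm : `[< ~ lgeq m Y X >] by exact/asboolP.
Qed.

Lemma finlen_mono Y Y' X X' : Y `<=` Y' -> X' `<=` X -> finlen Y X -> finlen Y' X'.
Proof.
by move=> YY' XX' [n nX]; exists n => /(lgeq_monor XX')/(lgeq_monol YY').
Qed.

Section Additivity.
Variables X Y Z : set V.
Hypotheses (HY : submod_set Y) (HZ : submod_set Z) (HX : submod_set X).
Hypotheses (YZ : Y `<=` Z) (ZX : Z `<=` X).

Lemma lgeq_split_sub k : lgeq k Y X ->
  exists n m, [/\ (k <= n + m)%N, lgeq n Y Z & lgeq m Z X].
Proof.
move=> /(lgeq_split HY HZ)[n [m [knm nI mD]]]; exists n, m; split=> //.
  by apply: lgeq_monor (lgeq_monol _ nI) => z; [case|move=> Yz; split=> //; exact: YZ].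
apply: lgeq_monor (lgeq_monol _ mD); first exact: addset_sub.
exact: addset_subr.
Qed.

Lemma finlenD : finlen Y Z -> finlen Z X -> finlen Y X.
Proof.
move=> [n nZ] [m mX]; exists (n + m)%N => /lgeq_split_sub[n' [m' [le n'Z m'X]]].
case: (leqP n n') => [le'|ltn]; first by apply: nZ; exact: lgeq_leq le' _.
case: (leqP m m') => [le'|ltm]; first by apply: mX; exact: lgeq_leq le' _.
by have := leq_ltn_trans le (leq_add ltn (ltnW ltm)); rewrite ltnn.
Qed.

(** Splitting a chain along Z gives one inequality, concatenating a chain below Z with one above it
    gives the other. *)
Lemma lenD : finlen Y X -> len Y X = (len Y Z + len Z X)%N.
Proof.
move=> fX; have fZ : finlen Y Z by exact: finlen_mono fX.
have fZX : finlen Z X by exact: finlen_mono fX.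
apply/eqP; rewrite eqn_leq; apply/andP; split.
  have /lgeq_split_sub[n [m [le /(lenP fZ) n1 /(lenP fZX) m1]]] := (lenP fX _).2 (leqnn _).
  exact: leq_trans le (leq_add n1 m1).
by apply/(lenP fX)/lgeq_cat; [exact: YZ|exact: ZX|exact/lenP|exact/lenP].
Qed.

Lemma finlen_sat : X `<=` sat p Y -> finlen Y X.
Proof. by move=> XY; exists 1%N => -[W [_ _ /subset_trans/(_ XY)WX [x /WX]]]. Qed.

Lemma len_sat : X `<=` sat p Y -> len Y X = 0%N.
Proof.
move=> XY; apply/eqP; rewrite -leqn0 leqNgt; apply/negP => /(lenP (finlen_sat XY)).
by move=> [W [_ _ /subset_trans/(_ XY)WX [x /WX]]].
Qed.

Lemma len_eq0 : finlen Y X -> len Y X = 0%N -> X `<=` sat p Y.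
Proof.
move=> fX l0 x Xx; apply: contrapT => nx.
have YX : Y `<=` X by exact: subset_trans ZX.
suff /(lenP fX) : lgeq 1 Y X by rewrite l0.
by exists X; split=> //; exists x.
Qed.

End Additivity.
End Basics.

Section Correspondence.
Variables (V W : lmodType R) (rho : V -> W -> Prop).
Hypothesis rhoD : forall a x x' y y', rho x x' -> rho y y' ->
  rho (a *: x + y) (a *: x' + y').

(** A linear relation inducing an isomorphism of X/Y with X'/Y' transports chains. Relations are
    allowed because the isomorphism used in [height_two], defined by t c = h d modulo a prime, comes
    without a map on representatives. *)
Lemma lgeq_rel n (X Y : set V) (X' Y' : set W) :
    submod_set X -> submod_set X' -> submod_set Y' -> Y `<=` X -> Y' `<=` X' ->
    (forall x, X x -> exists2 x', X' x' & rho x x') ->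
    (forall x', X' x' -> exists2 x, X x & rho x x') ->
    (forall x x', X x -> X' x' -> rho x x' -> (Y x <-> Y' x')) ->
  lgeq n Y X -> lgeq n Y' X'.
Proof.
move=> HX HX' + + + r1 r2; have r0 : rho 0 0.
  have [x' _ rx'] := r1 0 (submod_set0 HX).
  by have := rhoD (-1) rx' rx'; rewrite !scaleN1r !addNr.
have rZ a x x' : rho x x' -> rho (a *: x) (a *: x').
  by move=> /(rhoD a)/(_ r0); rewrite !addr0.
elim: n Y Y' => //= n IH Y Y' HY' YX Y'X' r3 [Z [HZ YZ ZX [x Zx xY] nZ]].
have r3Z y y' : X y -> X' y' -> rho y y' ->
    Z y <-> [set x' | X' x' /\ exists2 z, Z z & rho z x'] y'.
  move=> Xy X'y' ryy'; split=> [Zy|[_ [z Zz rzy']]]; first by split=> //; exists y.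
  (* Both z and y are related to y', so their difference is related to 0 and lies in Y, hence in
     Z. *)
  have Yzy : Y (- (1 : R) *: z + y).
    apply/(r3 _ 0); [|exact: submod_set0 HX'| |exact: submod_set0 HY'].
      by apply: submod_setD => //; apply: submod_setZ => //; exact: ZX.
    by rewrite -[0](addNr y') -[- y']scaleN1r; exact: rhoD.
  have Zz' : Z (- z) by exact: submod_setN.
  by move: (YZ _ Yzy); rewrite scaleN1r (submod_setDl HZ _ Zz').
have HZ' : submod_set [set x' | X' x' /\ exists2 z, Z z & rho z x'].
  split; first by split; [exact: submod_set0 HX'|exists 0; first exact: submod_set0 HZ].
  move=> a y y' [X'y [z Zz rzy]] [X'y' [z' Zz' rzy']].
  split; first by case: HX' => _; exact.
  by exists (a *: z + z'); [case: HZ => _; exact|exact: rhoD].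
eexists; split; [exact: HZ'| |by move=> ? []| |].
- move=> y' Y'y'; have X'y' := Y'X' _ Y'y'; split=> //.
  by have [y Xy ryy'] := r2 _ X'y'; exists y => //; apply/YZ/(r3 _ _ Xy X'y').
- have [x' X'x' rxx'] := r1 _ (ZX _ Zx); exists x'; first by split=> //; exists x.
  move=> [s sp Y'sx']; apply: xY; exists s => //.
  apply/(r3 _ (s *: x')) => //; last exact: rZ.
    by apply: submod_setZ => //; exact: ZX.
  exact: submod_setZ.
- by apply: (IH Z) => // x' [].
Qed.

End Correspondence.

Lemma len_rel V W (rho : V -> W -> Prop) (X Y : set V) (X' Y' : set W) :
    (forall a x x' y y', rho x x' -> rho y y' -> rho (a *: x + y) (a *: x' + y')) ->
    submod_set X -> submod_set Y -> submod_set X' -> submod_set Y' ->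
    Y `<=` X -> Y' `<=` X' ->
    (forall x, X x -> exists2 x', X' x' & rho x x') ->
    (forall x', X' x' -> exists2 x, X x & rho x x') ->
    (forall x x', X x -> X' x' -> rho x x' -> (Y x <-> Y' x')) ->
  (finlen Y X <-> finlen Y' X') /\ len Y X = len Y' X'.
Proof.
move=> rD HX HY HX' HY' YX YX' r1 r2 r3.
have E n : lgeq n Y X <-> lgeq n Y' X'.
  split; first exact: (lgeq_rel rD).
  apply: (@lgeq_rel _ _ (fun x' x => rho x x')) => //; first by move=> *; exact: rD.
  by move=> x' x X'x' Xx /(r3 _ _ Xx X'x')[].
split; first by split=> -[n nX]; exists n => /E.
by congr xget; apply/predeqP => n /=; split=> nE m; rewrite -nE E.
Qed.

(** The relation is that x' - f x lies in Y', so f has to reach X' only modulo Y'. *)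
Lemma len_map V W (f : V -> W) (X Y : set V) (X' Y' : set W) :
    linear f ->
    submod_set X -> submod_set Y -> submod_set X' -> submod_set Y' ->
    Y `<=` X -> Y' `<=` X' ->
    (forall x, X x -> X' (f x)) ->
    (forall x', X' x' -> exists2 x, X x & Y' (x' - f x)) ->
    (forall x, X x -> (Y x <-> Y' (f x))) ->
  (finlen Y X <-> finlen Y' X') /\ len Y X = len Y' X'.
Proof.
move=> lf HX HY HX' HY' YX YX' fX fs fY.
apply: (@len_rel _ _ (fun x x' => Y' (x' - f x))) => //.
- move=> a x x' y y' Hx Hy; rewrite lf opprD addrACA -scalerBr.
  by case: HY' => _; exact.
- by move=> x Xx; exists (f x); [exact: fX|rewrite subrr; exact: submod_set0].
move=> x x' Xx X'x' Hx; rewrite fY // -[x'](subrK (f x)).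
by rewrite (submod_setDl HY' _ Hx).
Qed.

End Length.

(** * Valuations of a Krull domain at height one primes *)

Section Valuations.
Variable R : idomainType.
Implicit Types (p q I J : ideal R) (a b c u x y : R).

(** The discrete valuation at p without fractions: the third clause is divisibility of b by a in the
    localization, with denominator s. The value at 0 is meaningless, whence the conditions on
    nonzero elements. *)
Definition valuation_at p (v : R -> nat) : Prop :=
  [/\ forall x y, x != 0 -> y != 0 -> v (x * y) = (v x + v y)%N,
      forall x, x != 0 -> (x \in p) = (0 < v x)%N,
      forall a b, a != 0 -> b != 0 -> (v a <= v b)%N ->
        exists2 s : R, s \notin p & exists c, s * b = c * a
    & exists2 u, u != 0 & v u = 1%N].

Lemma notin_neq0 p (x : R) : x \notin p -> x != 0.
Proof. by apply: contraNneq => ->; exact: (@rpred0 R^o p). Qed.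

Lemma krull_valuation p : krull R -> height_one_prime p -> exists v, valuation_at p v.
Proof.
move=> [_ /(_ p)dvr _] h1; have [w [wsurj wM _ locE]] := dvr h1.
have Hp : prime_ideal p by case: h1.
have loc (x y : R) : y \notin p -> localization p (tofrac x / tofrac y) by exists x, y.
have F0 (x : R) : x != 0 -> tofrac x != 0 :> {fraction R} by rewrite tofrac_eq0.
have w_ge0 z : z != 0 -> localization p z <-> 0 <= w z.
  by move=> z0; rewrite locE /=; split=> [[/eqP|]//|]; [rewrite (negPf z0)|right].
have w1 : w 1 = 0.
  by have := wM 1 1 (oner_neq0 _) (oner_neq0 _); rewrite mulr1 => /eqP; rewrite -subr_eq0 opprD addNKr oppr_eq0 => /eqP.
have wV z : z != 0 -> w z^-1 = - w z.
  move=> z0; apply/eqP; rewrite -addr_eq0 addrC -wM ?invr_eq0 // divff //; exact/eqP.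
have wF (x : R) : x != 0 -> 0 <= w (tofrac x).
  move=> x0; apply/w_ge0; first exact: F0.
  by rewrite -[tofrac x]divr1 -tofrac1; apply: loc; exact: prime_ideal1.
have wp (x : R) : x \notin p -> w (tofrac x) = 0.
  move=> xp; have x0 := notin_neq0 xp; apply/eqP; rewrite eq_le wF // andbT.
  rewrite -oppr_ge0 -wV ?F0 //; apply/w_ge0; first by rewrite invr_eq0 F0.
  by rewrite -div1r -tofrac1; exact: loc.
pose v (x : R) := absz (w (tofrac x)).
have vE (x : R) : x != 0 -> (v x)%:Z = w (tofrac x) by move=> x0; rewrite /v gez0_abs // wF.
exists v; split.
- move=> x y x0 y0; apply/eqP; rewrite -(eqr_nat int) natrD !natz !vE ?mulf_neq0 //.
  by rewrite tofracM wM ?F0.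
- move=> x x0; case: (boolP (x \in p)) => xp; last by rewrite -ltz_nat vE // wp.
  rewrite lt0n; apply/esym/negP => /eqP vx.
  have wx : w (tofrac x) = 0 by rewrite -vE // vx.
  have : localization p (tofrac x)^-1.
    by apply/w_ge0; rewrite ?invr_eq0 ?F0 // wV ?F0 // wx.
  move=> [a [s [sp /(congr1 (fun z => z * tofrac x * tofrac s))]]].
  rewrite mulVf ?F0 // mul1r mulrAC divfK ?F0 ?(notin_neq0 sp) //.
  move/eqP; rewrite -tofracM tofrac_eq => /eqP sE.
  by move: sp; rewrite sE ideal_mull.
- move=> a b a0 b0 vab; have : localization p (tofrac b / tofrac a).
    apply/w_ge0; first by rewrite mulf_neq0 ?invr_eq0 ?F0.
    by rewrite wM ?invr_eq0 ?F0 // wV ?F0 // subr_ge0 -!vE.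
  move=> [c [s [sp /(congr1 (fun z => z * tofrac a * tofrac s))]]].
  have s0 := notin_neq0 sp.
  rewrite divfK ?F0 // mulrAC divfK ?F0 // -!tofracM => /eqP.
  by rewrite tofrac_eq => /eqP E; exists s => //; exists c; rewrite mulrC.
(* A fraction of value 1 is some x / y with y outside p; as y has value 0, x has value 1. *)
- have [z z0 wz] := wsurj 1; have : localization p z by apply/w_ge0; rewrite ?wz.
  move=> [x [y [yp zE]]]; have y0 := notin_neq0 yp.
  have x0 : x != 0 by apply: contraNneq z0 => x0; rewrite zE x0 tofrac0 mul0r.
  exists x => //; move: wz; rewrite zE wM ?invr_eq0 ?F0 // wV ?F0 // (wp y) // subr0.
  by rewrite -vE // => -[].
Qed.

Section Valuation.
Variables (p : ideal R) (v : R -> nat).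
Hypotheses (Hp : prime_ideal p) (Hv : valuation_at p v).

(** The n-th symbolic power of p; 0 is added by hand because its value is meaningless. *)
Definition vge n : set R^o := [set a | (a : R) = 0 \/ (n <= v a)%N].

Lemma valM x y : x != 0 -> y != 0 -> v (x * y) = (v x + v y)%N.
Proof. by case: Hv => + _ _ _; exact. Qed.

Lemma val_notin (s : R) : s \notin p -> v s = 0%N.
Proof.
move=> sp; case: Hv => _ /(_ s (notin_neq0 sp))E _ _.
by apply/eqP; rewrite -leqn0 leqNgt -E.
Qed.

Lemma val_dvd a b : a != 0 -> vge (v a) b -> exists2 s : R, s \notin p & exists c, s * b = c * a.
Proof.
move=> a0; case: (eqVneq b 0) => [-> _|b0].
  by exists 1; [exact: prime_ideal1|exists 0; rewrite mulr0 mul0r].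
by move=> [/eqP|ab]; [rewrite (negPf b0)|case: Hv => _ _ + _; exact].
Qed.

Lemma vge_mul m n x y : vge m x -> vge n y -> vge (m + n) (x * y).
Proof.
case: (eqVneq x 0) => [->|x0]; first by rewrite mul0r; left.
case: (eqVneq y 0) => [->|y0]; first by rewrite mulr0; left.
move=> [/eqP|mx]; first by rewrite (negPf x0).
move=> [/eqP|ny]; first by rewrite (negPf y0).
by right; rewrite valM // leq_add.
Qed.

Lemma vge0 x : vge 0 x. Proof. by right. Qed.

Lemma vge_le m n x : (m <= n)%N -> vge n x -> vge m x.
Proof. by move=> mn [->|nx]; [left|right; exact: leq_trans nx]. Qed.

Lemma vge_notin (s : R) n x : s \notin p -> vge n (s * x) -> vge n x.
Proof.
move=> sp; case: (eqVneq x 0) => [->|x0]; first by left.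
by move=> [/eqP|]; rewrite ?mulf_eq0 ?(negPf x0) ?(negPf (notin_neq0 sp)) // valM ?(notin_neq0 sp) // val_notin //; right.
Qed.

(** The ultrametric inequality follows from divisibility: if v x <= v y, then s y = c x with s
    outside p, and s (x + y) = (s + c) x. *)
Lemma vgeD n x y : vge n x -> vge n y -> vge n (x + y).
Proof.
wlog xy : x y / x != 0 /\ vge (v x) y => [H nx ny|nx _].
  case: (eqVneq x 0) => [->|x0]; first by rewrite add0r.
  case: (eqVneq y 0) => [->|y0]; first by rewrite addr0.
  case: (leqP (v x) (v y)) => [xy|/ltnW yx]; first by apply: H => //; split=> //; right.
  by rewrite addrC; apply: H => //; split=> //; right.
case: xy => x0 /(val_dvd x0)[s sp [c E]].
apply: (vge_notin sp); rewrite mulrDr E -mulrDl -[n]add0n.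
exact: vge_mul (vge0 _) nx.
Qed.

Lemma submod_vge n : submod_set (vge n).
Proof.
split=> [|a x y nx ny]; first by left.
apply: (@vgeD n (a * x) y) => //; rewrite -[n]add0n.
exact: vge_mul (vge0 _) nx.
Qed.

Lemma vge1_in x : vge 1 x <-> x \in p.
Proof.
case: (eqVneq x 0) => [->|x0].
  by split=> _; [exact: (@rpred0 R^o p)|left].
case: Hv => _ /(_ x x0) -> _ _; split=> [[/eqP|//]|]; last by right.
by rewrite (negPf x0).
Qed.

Lemma val_unif : exists u, [/\ u != 0, u \in p & forall n, v (u ^+ n) = n].
Proof.
case: (Hv) => _ _ _ [u u0 vu]; exists u; split=> //; first by apply/vge1_in; right; rewrite vu.
elim=> [|n IH]; first by rewrite expr0 val_notin // prime_ideal1.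
by rewrite exprS valM ?expf_neq0 // IH vu.
Qed.

Lemma ideal_exp_vge n x : x \in ideal_exp p n -> vge n x.
Proof.
elim: n x => [|n IH] x; first by move=> _; exact: vge0.
rewrite unfold_in => /asboolP[s [/allP sP ->]]; rewrite big_seq_cond.
apply: (submod_set_sum (submod_vge _)) => u; rewrite andbT => /sP/andP[u1 u2].
by rewrite -add1n; apply: vge_mul; [exact/vge1_in|exact: IH].
Qed.

Lemma ideal_mul_mem I J x y : x \in I -> y \in J -> x * y \in ideal_mul I J.
Proof.
move=> xI yJ; rewrite unfold_in; apply/asboolP; exists [:: (x, y)].
by rewrite /= xI yJ big_seq1.
Qed.

Lemma ideal_exp_mem I x n : x \in I -> x ^+ n \in ideal_exp I n.
Proof.
by move=> xI; elim: n => [|n IH]; rewrite ?unfold_in // exprS; exact: ideal_mul_mem.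
Qed.

Lemma vge_ideal_exp n x : vge n x -> exists2 s : R, s \notin p & s * x \in ideal_exp p n.
Proof.
have [u [u0 up vu]] := val_unif; rewrite -{1}(vu n) => /val_dvd[|s sp [c E]].
  by rewrite expf_neq0.
by exists s => //; rewrite E; apply: ideal_mull; exact: ideal_exp_mem.
Qed.

(** An x with v a <= v x satisfies s x = c a for some s outside p, so it lies in the saturation of
    I. Each term of a chain therefore brings in an element of smaller value, and v a bounds the
    length. *)
Lemma lgeq_val n (I : set R^o) a : a != 0 -> I a -> submod_set I ->
  lgeq p n I setT -> (n <= v a)%N.
Proof.
elim: n I a => // n IH I a a0 Ia HI [Z [HZ IZ _ [x Zx xI] nZ]].
case: (leqP (v a) (v x)) => [ax|xa].
  have [|s sp [c E]] := @val_dvd a x a0; first by right.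
  case: xI; exists s => //.
  by apply: (eq_ind (c * a) I (submod_setZ HI c Ia)); rewrite -E.
apply: leq_trans xa; rewrite ltnS; apply: (IH Z) => //.
by apply: contra_notN xI => /eqP->; apply: (sub_sat Hp); exact: submod_set0 HI.
Qed.

Lemma finlen_ideal (I : set R^o) a : a != 0 -> I a -> submod_set I -> finlen p I setT.
Proof. by move=> a0 Ia HI; exists (v a).+1 => /(lgeq_val a0 Ia HI); rewrite ltnn. Qed.

(** For a uniformizer u, the element u^n bounds the length by n. The powers of p form a chain of
    that length, since u^k is not in p^(k+1) even after saturation. *)
Lemma len_ideal_exp n : len p [set x | x \in ideal_exp p n] setT = n.
Proof.
have [u [u0 up vu]] := val_unif.
have HI m := submod_set_mem (ideal_exp p m).
have fl : finlen p [set x | x \in ideal_exp p n] setT.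
  by apply: (@finlen_ideal _ (u ^+ n)) => //; [rewrite expf_neq0|exact: ideal_exp_mem].
apply/eqP; rewrite eqn_leq; apply/andP; split.
  rewrite -[X in (_ <= X)%N](vu n).
  apply: (@lgeq_val _ [set x | x \in ideal_exp p n]) => //; [by rewrite expf_neq0|exact: ideal_exp_mem|].
  exact/(lenP fl).
apply/(lenP fl) => {fl}; elim: n => //= n IH; exists [set x | x \in ideal_exp p n].
split=> //.
  move=> x /=; rewrite unfold_in => /asboolP[s [/allP sP ->]]; rewrite big_seq_cond.
  apply: (submod_set_sum (HI n)) => w; rewrite andbT => /sP/andP[_].
  exact: ideal_mull.
exists (u ^+ n); first exact: ideal_exp_mem.
move=> [s sp sI]; have /(vge_notin sp) : vge n.+1 (s * u ^+ n) by exact: (@ideal_exp_vge n.+1 (s * u ^+ n) sI).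
by case=> [/eqP|]; rewrite ?expf_eq0 ?(negPf u0) ?andbF // vu ltnn.
Qed.

(** One more generator g contributes the cyclic module R/I, where I is the ideal of multipliers of g
    into [span s]; it contains a. *)
Lemma finlen_torsion (V : lmodType R) (s : seq V) a : a != 0 ->
  (forall x : V, span s x -> a *: x = 0) -> finlen p [set 0] (span s).
Proof.
move=> a0; elim: s => [|g s IH] aV.
  by apply: finlen_sat => x /span_nil->; exact: (sub_sat Hp).
have ss : span s `<=` span (g :: s) by apply: span_mono => x xs; rewrite inE xs orbT.
apply: (@finlenD R p Hp V _ _ (span s)) => //.
- exact: submod_set1.
- exact: submod_span.
- exact: submod_span.
- by move=> _ ->; exact: submod_set0 (submod_span s).
- by apply: IH => x /ss; exact: aV.
pose I : set R^o := [set r | span s ((r : R) *: g)].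
have lg : linear (fun r : R^o => (r : R) *: g) by move=> b x y; rewrite scalerDl scalerA.
have HI : submod_set I := submod_preimage lg (submod_span s).
have fs (x : V) : span (g :: s) x ->
    exists2 r : R^o, [set: R^o] r & span s (x - (r : R) *: g).
  move=> /span_cons[b [y [sy ->]]]; exists b => //.
  by rewrite addrAC subrr add0r.
have fX (r : R^o) : [set: R^o] r -> span (g :: s) ((r : R) *: g).
  by move=> _; apply: submod_setZ; [exact: submod_span|exact/mem_span/mem_head].
have [E _] := len_map p lg (submod_setT _) HI (submod_span _) (submod_span _)
  (@subsetT _ _) ss fX fs (fun r _ => iff_refl _).
apply/E.
apply: (@finlen_ideal I a) => //; rewrite /I /= aV; first exact: submod_set0 (submod_span s).
exact/mem_span/mem_head.
Qed.

Lemma finlen_fin_gen (V : lmodType R) : fin_gen V -> torsion V -> finlen p [set (0 : V)] setT.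
Proof.
move=> fV tV; have [a a0 aV] := ann_neq0 fV tV; have [s sV] := (fin_genP V).1 fV.
apply: finlen_mono (finlen_torsion a0 (fun (x : V) (_ : span s x) => aV x)) => // x _.
exact/sV.
Qed.

End Valuation.
End Valuations.

(** * Quotient maps and families with one more member *)

Section QuotientProjection.
Variables (R : idomainType) (V : lmodType R) (S : submodClosed V).
Local Open Scope quotient_scope.

Definition qpi (x : V) : quotmodule S := \pi_(quotmodule S) x.

Lemma qpi_linear : linear qpi.
Proof.
move=> a x y; rewrite /qpi pi_quotmoduleD; congr (_ + _).
exact/esym/quotmodule_scaleE.
Qed.

Lemma qpi_eq x y : qpi x = qpi y <-> x - y \in S.
Proof. by split=> [/eqP|H]; [|apply/eqP]; rewrite pi_quotmoduleE. Qed.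

Lemma linear_at0 (U W : lmodType R) (f : U -> W) : linear f -> f 0 = 0.
Proof. by move=> /(_ (-1) 0 0); rewrite scaler0 addr0 scaleN1r addNr. Qed.

Lemma linear_atZ (U W : lmodType R) (f : U -> W) a x : linear f -> f (a *: x) = a *: f x.
Proof. by move=> lf; rewrite -[a *: x]addr0 lf linear_at0 // addr0. Qed.

Lemma linear_atB (U W : lmodType R) (f : U -> W) x y : linear f -> f (x - y) = f x - f y.
Proof. by move=> lf; rewrite addrC -scaleN1r lf scaleN1r addrC. Qed.

Lemma qpi_eq0 x : qpi x = 0 <-> x \in S.
Proof. by rewrite -(linear_at0 qpi_linear) qpi_eq subr0. Qed.

Lemma qpi_surj z : exists x, z = qpi x.
Proof. by elim/quotW: z => x; exists x. Qed.

End QuotientProjection.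

(* Carries a classical eqType structure, so that ideals can be listed and counted. *)
Definition ideal_alias (R : idomainType) := ideal R.
HB.instance Definition _ (R : idomainType) := gen_eqMixin (ideal_alias R).
HB.instance Definition _ (R : idomainType) := gen_choiceMixin (ideal_alias R).

Section Ocons.
Variables (T : Type) (n : nat).

Definition ocons (t : T) (f : 'I_n -> T) (i : 'I_n.+1) : T :=
  let: Ordinal m lt := i in
  (if m is m'.+1 as m0 return (m0 < n.+1)%N -> T
   then fun lt' => f (@Ordinal n m' lt') else fun=> t) lt.

Lemma ocons_lift t f i : ocons t f (lift ord0 i) = f i.
Proof. by rewrite /ocons /=; congr f; exact: val_inj. Qed.

(** Matching on the ordinal itself lets both components reduce on explicit ordinals, with no
    transport along equalities of indices. *)
Definition docons (V : 'I_n.+1 -> Type) (t : forall lt, V (@Ordinal n.+1 0 lt))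
    (f : forall m lt, V (@Ordinal n.+1 m.+1 lt)) (i : 'I_n.+1) : V i :=
  let: Ordinal m lt as i0 := i return V i0 in
  (if m is m'.+1 as m0 return forall lt0, V (@Ordinal n.+1 m0 lt0) then f m' else t) lt.

End Ocons.

(** * Splitting off a cyclic factor at a height one prime *)

Section Structure.
Variable R : idomainType.
Hypotheses (nR : noetherian R) (kR : krull R).
Implicit Types (p q : ideal R).

(** Only finitely many height one primes contain a. For each such q other than p, minimality of p
    gives an element of q outside p; raised to the power v_q(a) it is divisible by a at q. The
    product of these powers is s. *)
Lemma avoid_primes p (a : R) : height_one_prime p -> a != 0 ->
  exists2 s : R, s \notin p & forall q, height_one_prime q -> ~ q =i p ->
    exists2 u : R, u \notin q & exists c, u * s = c * a.
Proof.
move=> hp a0; have Hp : prime_ideal p by case: hp.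
have [_ _ /(_ a a0)/(finite_seqP (T := ideal_alias R))[l lE]] := kR.
have one q : exists2 w : R, w \notin p & height_one_prime q -> ~ q =i p ->
    exists2 u : R, u \notin q & exists c, u * w = c * a.
  case: (pselect (height_one_prime q /\ ~ q =i p)) => [[hq qp]|nq]; last first.
    by exists 1 => [|hq qp]; [exact: prime_ideal1|case: nq].
  have [w0 w0q w0p] : exists2 w : R, w \in q & w \notin p.
    apply: contrapT => nw; apply: qp => x; apply/idP/idP => xpq.
      by apply: contrapT => /negP xp; apply: nw; exists x.
    apply: (height_one_min hp _ (height_one_neq0 hq)) xpq; first by case: hq.
    by move=> y yq; apply: contrapT => /negP yp; apply: nw; exists y.
  have [v Hv] := krull_valuation kR hq; have Hq : prime_ideal q by case: hq.
  exists (w0 ^+ v a); first exact: prime_ideal_notX.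
  move=> _ _; apply: (val_dvd Hq Hv a0).
  elim: (v a) => [|n IH]; first exact: vge0.
  by rewrite exprS -add1n; apply: (vge_mul Hv) => //; exact/(vge1_in Hv).
have [s sp sq] : exists2 s : R, s \notin p & forall q : ideal_alias R, q \in (l : seq (ideal_alias R)) ->
    height_one_prime q -> ~ q =i p -> exists2 u : R, u \notin q & exists c, u * s = c * a.
  elim: (l : seq (ideal_alias R)) => [|q l' [s sp IH]]; first by exists 1 => //; exact: prime_ideal1.
  have [w wp wq] := one q; exists (w * s); first exact: prime_ideal_notM.
  move=> q'; rewrite inE => /orP[/eqP->|q'l] hq' q'p.
    have [u uq [c E]] := wq hq' q'p; exists u => //; exists (s * c).
    by rewrite mulrA E mulrC mulrA.
  have [u uq [c E]] := IH q' q'l hq' q'p; exists u => //; exists (w * c).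
  by rewrite mulrCA E mulrA.
exists s => // q hq qp; case: (boolP (a \in q)) => aq; last first.
  by exists a => //; exists s; rewrite mulrC.
apply: sq => //; have : [set` l] (q : ideal_alias R); last by [].
rewrite -lE; split=> // -[z [x [y [yq ->]]]].
have y0 : tofrac y != 0 by rewrite tofrac_eq0 (notin_neq0 yq).
move/(congr1 (fun z => z * tofrac y)); rewrite mulrA divfK // mul1r => /eqP.
rewrite -tofracM tofrac_eq => /eqP yE.
by move: yq; rewrite -yE mulrC ideal_mull.
Qed.

Variable N : lmodType R.
Hypotheses (fN : fin_gen N) (tN : torsion N).

Section Step.
Variables (p : ideal R) (v : R -> nat).
Hypotheses (hp : height_one_prime p) (Hv : valuation_at p v).
Let Hp : prime_ideal p. Proof. by case: hp. Qed.
Variable X : set N.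
Hypothesis HX : submod_set X.

(** Here e is the exponent of N/X at p. By minimality of e some element attains it, for otherwise e
    - 1 would do. *)
Lemma max_order x0 : ~ sat p X x0 ->
  exists e x, [/\ (0 < e)%N, forall b, X (b *: x) -> vge v e b,
    forall y, exists b, [/\ b != 0, X (b *: y) & (v b <= e)%N]
    & forall q, height_one_prime q -> ~ q =i p -> sat q X x].
Proof.
move=> nx0; have [a a0 aN] := ann_neq0 fN tN.
pose P e := `[< forall y, exists b, [/\ b != 0, X (b *: y) & (v b <= e)%N] >].
have exP : exists e, P e.
  by exists (v a); apply/asboolP => y; exists a; rewrite aN; split=> //; exact: submod_set0.
case: (ex_minnP exP) => e /asboolP Pe mine; exists e.
have e0 : (0 < e)%N.
  rewrite lt0n; apply/eqP => e0; apply: nx0.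
  have [b [b0 Xb vb]] := Pe x0; exists b => //; case: Hv => _ /(_ b b0) -> _ _.
  by rewrite -leqNgt -e0.
have [x Hx] : exists x, forall b, X (b *: x) -> vge v e b.
  apply: contrapT => nx; have : ~~ P e.-1.
    by apply/negP => /mine; rewrite leqNgt prednK // leqnn.
  move/asboolP; apply => y; apply: contrapT => nb; apply: nx; exists y => b Xb.
  case: (eqVneq b 0) => [->|b0]; [by left|right].
  rewrite leqNgt; apply/negP => be; apply: nb; exists b; split=> //.
  by rewrite -ltnS prednK.
(* Multiplication by s keeps the order at p, as s is outside p, and moves x into X at every other
   height one prime, where s is a multiple of a and a kills N. *)
have [s sp sq] := avoid_primes hp a0; exists (s *: x); split=> //.
  move=> b; rewrite scalerA mulrC => /Hx; exact: (vge_notin Hv).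
move=> q hq qp; have [u uq [c E]] := sq q hq qp; exists u => //.
by rewrite scalerA E -scalerA aN scaler0; exact: submod_set0.
Qed.

Variables (e : nat) (x : N).
Hypotheses (xe : forall b, X (b *: x) -> vge v e b)
  (eN : forall y, exists b, [/\ b != 0, X (b *: y) & (v b <= e)%N]).

(* G is the graph of a maximal partial homomorphism from N to A modulo the e-th
   symbolic power of p that kills X and sends x to 1; divisibility in the
   valuation ring at p shows that its domain is everything at p. *)
Lemma partial_hom : exists G : set (N * R^o), [/\ submod_set G,
  forall y, X y -> G (y, 0), G (x, 1), forall c, G (0, c) -> vge v e c
  & forall g, exists2 s : R, s \notin p & exists d, G (s *: g, d)].
Proof.
pose P (G : set (N * R^o)) := submod_set G /\ forall c, G (0, c) -> vge v e c.
pose G0 : set (N * R^o) := [set w | X (w.1 - (w.2 : R) *: x)].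
have nV : noeth (N * R^o)%type.
  apply: noeth_module => //; have [n [g gN]] := fN.
  exists n.+1, (ocons (0, 1) (fun i => (g i, 0))) => -[y r]; have [a yE] := gN y.
  exists (ocons r a); rewrite big_ord_recl.
  rewrite (eq_bigr (fun i => (a i *: g i, 0) : N * R^o)); last first.
    by move=> i _; rewrite !ocons_lift; congr pair; rewrite /= scaler0.
  have -> : \sum_(i < n) ((a i *: g i, 0) : N * R^o) = (\sum_(i < n) a i *: g i, 0).
    by elim/big_ind2: _ => // x1 x2 y1 y2 -> ->; congr pair; rewrite addr0.
  rewrite -yE; congr pair; rewrite /= ?scaler0 ?add0r // addr0.
  by rewrite -[RHS]/(r * 1) mulr1.
have PG0 : P G0.
  split; first split.
  - by rewrite /G0 /= scale0r subr0; exact: submod_set0.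
  - move=> a [y r] [y' r']; rewrite /G0 /= => Xy Xy'.
    rewrite -[a *: r + r']/(a * r + r') scalerDl opprD addrACA -scalerA -scalerBr.
    by case: HX => _; exact.
  - move=> c; rewrite /G0 /= sub0r => /(submod_setN HX); rewrite opprK; exact: xe.
have [G [[HG Ge] G0G maxG]] := @noeth_max _ _ P G0 nV (fun _ H => H.1) PG0.
have XG y : X y -> G (y, 0) by move=> Xy; apply: G0G; rewrite /G0 /= scale0r subr0.
have GZ a y d : G (y, d) -> G (a *: y, a * d) by exact: (submod_setZ HG a).
have GD y d y' d' : G (y, d) -> G (y', d') -> G (y + y', d + d') by exact: (submod_setD HG).
have GB y d y' d' : G (y, d) -> G (y', d') -> G (y - y', d - d') by exact: (submod_setB HG).
exists G; split=> //; first by apply: G0G; rewrite /G0 /= scale1r subrr; exact: submod_set0.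
move=> g; have [b [b0 Xb vb]] := eN g.
(* The multiplier r0 of least value generates, at p, the ideal of those r with r g in the domain of
   G. With s b = c' r0 one has v r0 + v c' = v b <= e, while c' c has value at least e; so v r0 <= v
   c, and c can be divided by r0 at p. *)
pose Q j := `[< exists r c, [/\ r != 0, G (r *: g, c) & v r = j] >].
have exQ : exists j, Q j by exists (v b); apply/asboolP; exists b, 0; split=> //; exact: XG.
case: (ex_minnP exQ) => j /asboolP[r0 [c [r00 Gr0 vr0]]] minj.
have minr r c' : G (r *: g, c') -> vge v (v r0) r.
  case: (eqVneq r 0) => [->|rn0 Gr]; [by left|right].
  by rewrite vr0; apply: minj; apply/asboolP; exists r, c'.
have [s sp [c' E]] := val_dvd Hp Hv r00 (minr b 0 (XG _ Xb)).
have Hc'c : vge v e (c' * c).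
  have Gb : G (s *: (b *: g), 0) by apply: XG; exact: submod_setZ.
  apply: Ge; have := GB _ _ _ _ (GZ c' _ _ Gr0) Gb.
  by rewrite !scalerA E subrr subr0.
have Hc : vge v (v r0) c.
  have c'0 : c' != 0.
    apply: contraTneq isT => c'0; move/eqP: E; rewrite c'0 mul0r mulf_eq0.
    by rewrite (negPf b0) (negPf (notin_neq0 sp)).
  have vE : (v r0 + v c' = v b)%N.
    by rewrite addnC -(valM Hv) // -E (valM Hv) ?(notin_neq0 sp) // (val_notin Hv sp).
  case: (eqVneq c 0) => [->|c0]; [by left|right].
  case: Hc'c => [/eqP|]; first by rewrite mulf_eq0 (negPf c'0) (negPf c0).
  rewrite (valM Hv) // => /(leq_trans vb); rewrite -vE addnC leq_add2l; exact.
(* Since d r0 = s' c, the value d at [s' *: g] is compatible with G. Adjoining this pair gives G',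
   and maximality puts the pair in G. *)
have [s' s'p [d Ed]] := val_dvd Hp Hv r00 Hc.
exists s' => //; exists d.
pose G' : set (N * R^o) := [set w | exists r : R, G (w.1 - r *: (s' *: g), w.2 - r * d)].
apply: (maxG G').
- split; first split.
  + by exists 0; rewrite /= scale0r mul0r !subrr; exact: submod_set0 HG.
  + move=> a [y1 d1] [y2 d2] [r1 /= H1] [r2 /= H2]; exists (a * r1 + r2) => /=.
    rewrite -[a *: d1 + d2]/(a * d1 + d2).
    rewrite scalerDl mulrDl !opprD addrACA (addrACA (a * d1)) -scalerA -scalerBr.
    by rewrite -mulrA -mulrBr; apply: GD => //; exact: GZ.
  + move=> c1 [r /= Hr]; rewrite sub0r in Hr.
    have Hr' : G ((r * s') *: g, r * d - c1).
      by have := submod_setN HG Hr; rewrite /= -scalerA -[- (_, _)]/(- - _, - (_ - _)) opprK opprB.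
    have [s'' s''p [w Ew]] := val_dvd Hp Hv r00 (minr _ _ Hr').
    apply: (vge_notin Hv s'p); apply: (vge_notin Hv s''p).
    have H : vge v e (w * c - s'' * (r * d - c1)).
      apply: Ge; have := GB _ _ _ _ (GZ w _ _ Gr0) (GZ s'' _ _ Hr').
      by rewrite !scalerA Ew subrr.
    have := vge_mul Hv (vge0 v s') H; rewrite add0n; congr vge.
    have Ew' : s' * (s'' * (r * d)) = s' * (w * c).
      rewrite [RHS]mulrCA Ed [RHS]mulrCA -Ew [LHS]mulrCA [RHS]mulrCA.
      by congr (_ * _); rewrite [LHS]mulrCA [RHS]mulrCA [d * s']mulrC.
    rewrite !mulrBr Ew' opprB addrCA subrr addr0.
    by rewrite mulrCA.
- by move=> [y d1] Gy; exists 0; rewrite /= scale0r mul0r !subr0.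
- by exists 1; rewrite /= scale1r mul1r !subrr; exact: submod_set0 HG.
Qed.

(** Two denominators turn the partial map into a map on N: u multiplies N into the domain of G, and
    s2 multiplies the e-th symbolic power of p into p^e. The image of y is s2 d for any d with (u y,
    d) in G. *)
Lemma hom_to_cyclic : exists2 f : N -> quotmodule (ideal_exp p e), linear f &
  (forall y, X y -> f y = 0) /\ exists2 s : R, s \notin p & f x = qpi (ideal_exp p e) s.
Proof.
have [G [HG XG Gx Ge Gs]] := partial_hom.
have GZ a y d : G (y, d) -> G (a *: y, a * d) by exact: (submod_setZ HG a).
have GB y d y' d' : G (y, d) -> G (y', d') -> G (y - y', d - d') by exact: (submod_setB HG).
pose D : set N := [set y | exists d, G (y, d)].
have HD : submod_set D.
  split=> [|a y y' [d Gd] [d' Gd']]; first by exists 0; exact: submod_set0 HG.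
  by exists (a * d + d'); apply: (submod_setD HG (x := (_, _)) (y := (_, _))) => //; exact: GZ.
have [sN NE] := (fin_genP N).1 fN.
have [|u up uD] := @sat_span R p N Hp D sN HD; first by move=> y _; have [s sp [d Gd]] := Gs y; exists s => //; exists d.
have [se seE] := noeth_ring nR (submod_vge Hp Hv e).
have [|s2 s2p s2e] := @sat_span R p R^o Hp [set c | c \in ideal_exp p e] se (submod_set_mem _).
  by move=> c /seE /(vge_ideal_exp Hp Hv)[s sp sc]; exists s.
have {}s2e (c : R) : vge v e c -> s2 * c \in ideal_exp p e by move=> /seE/s2e.
have /choice[d Gd] : forall y, exists d, G (u *: y, d) by move=> y; apply: uD; apply/NE.
have dE y (c : R) : G (u *: y, c) -> qpi (ideal_exp p e) (s2 * d y) = qpi (ideal_exp p e) (s2 * c).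
  move=> Gc; apply/qpi_eq; have := s2e (d y - c); rewrite mulrBr; apply.
  by apply: Ge; rewrite -(subrr (u *: y)); exact: GB.
exists (fun y => qpi (ideal_exp p e) (s2 * d y)).
  move=> a y y'; rewrite -qpi_linear.
  rewrite (@dE _ (a * d y + d y')).
    by congr qpi; rewrite mulrDr -[a *: _]/(a * _) mulrCA.
  rewrite scalerDr scalerA mulrC -scalerA.
  exact: (submod_setD HG (GZ a _ _ (Gd y)) (Gd y')).
split=> [y Xy|].
  rewrite (@dE _ 0); last by apply: XG; exact: submod_setZ.
  by apply/qpi_eq0; rewrite mulr0; exact: (@rpred0 R^o).
exists (s2 * u); first exact: prime_ideal_notM.
by apply: dE; have := GZ u _ _ Gx; rewrite mulr1.
Qed.

End Step.
End Structure.

(** * Elementary modules *)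

Section PrimePowersCons.
Variables (R : idomainType) (p : ideal R) (e : nat) (d : prime_powers R).
Hypotheses (hp : height_one_prime p) (e0 : (0 < e)%N).

Let pr := ocons p (@pp_prime R d).
Let ex := ocons e (@pp_exp R d).

Fact pp_cons_height_one i : height_one_prime (pr i).
Proof. by case: i => -[|m] lt //; exact: pp_height_one. Qed.
Fact pp_cons_exp_gt0 i : (0 < ex i)%N.
Proof. by case: i => -[|m] lt //; exact: pp_exp_gt0. Qed.

Definition pp_cons : prime_powers R := PrimePowers pp_cons_height_one pp_cons_exp_gt0.

Definition econs (z0 : quotmodule (ideal_exp p e)) (z : elementary_module d) :
    elementary_module pp_cons :=
  @docons (pp_size d) (fun i => quotmodule (ideal_exp (pr i) (ex i)))
    (fun=> z0) (fun m lt => z (@Ordinal (pp_size d) m lt)).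

Lemma econs_surj (w : elementary_module pp_cons) : exists z0 z, w = econs z0 z.
Proof.
exists (w (@Ordinal (pp_size d).+1 0 isT)), (fun i => let: Ordinal m lt as i0 := i return
    quotmodule (ideal_exp (pp_prime i0) (pp_exp i0)) in w (@Ordinal (pp_size d).+1 m.+1 lt)).
apply: functional_extensionality_dep => -[[|m] lt] //=.
by rewrite (bool_irrelevance lt isT).
Qed.

Lemma econs_linear a z0 z w0 w :
  econs (a *: z0 + w0) (a *: z + w) = a *: econs z0 z + econs w0 w.
Proof. by apply: functional_extensionality_dep => -[[|m] lt]. Qed.

Lemma econsZ a z0 z : econs (a *: z0) (a *: z) = a *: econs z0 z.
Proof. by apply: functional_extensionality_dep => -[[|m] lt]. Qed.

Lemma econs_eq0 z0 z : econs z0 z = 0 <-> z0 = 0 /\ z = 0.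
Proof.
split=> [H|[-> ->]]; last by apply: functional_extensionality_dep => -[[|m] lt].
split; first exact: (congr1 (fun f => f (@Ordinal (pp_size d).+1 0 isT)) H).
apply: functional_extensionality_dep => -[m lt].
exact: (congr1 (fun f => f (@Ordinal (pp_size d).+1 m.+1 lt)) H).
Qed.

End PrimePowersCons.
Arguments econs {R p e d} hp e0 z0 z.

Section ElementaryModule.
Variables (R : idomainType) (d : prime_powers R).
Implicit Types z : elementary_module d.

Lemma elem_sumE (I : Type) (r : seq I) (F : I -> elementary_module d) j :
  (\sum_(i <- r) F i) j = \sum_(i <- r) F i j.
Proof. by elim: r => [|i r IH]; rewrite ?big_nil // !big_cons -IH. Qed.

Lemma elem_fin_gen : fin_gen (elementary_module d).
Proof.
exists (pp_size d), (fun i j => qpi _ ((i == j)%:R : R^o)) => z.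
have /choice[c cE] : forall i, exists a : R^o, z i = qpi _ a by move=> i; exact: qpi_surj.
exists c; apply: functional_extensionality_dep => j; rewrite elem_sumE.
rewrite (bigD1 j) //= big1 => [|i ij]; last first.
  rewrite [LHS](_ : _ = c i *: qpi (ideal_exp (pp_prime j) (pp_exp j)) ((i == j)%:R : R^o)) //.
  by rewrite (negPf ij) (_ : qpi _ _ = 0) ?scaler0 //; apply/qpi_eq0; exact: rpred0.
rewrite addr0 [RHS](_ : _ = c j *: qpi (ideal_exp (pp_prime j) (pp_exp j)) ((j == j)%:R : R^o)) //.
rewrite eqxx cE -(linear_atZ _ _ (@qpi_linear _ _ _)); congr qpi.
by rewrite -[RHS]/(c j * 1) mulr1.
Qed.

Lemma elem_torsion : torsion (elementary_module d).
Proof.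
have /choice[a aP] : forall i, exists a : R, a != 0 /\ a \in ideal_exp (pp_prime i) (@pp_exp R d i).
  move=> i; have [x xp x0] := height_one_neq0 (@pp_height_one R d i).
  by exists (x ^+ pp_exp i); rewrite expf_neq0 // ideal_exp_mem.
move=> z; exists (\prod_i a i); first by apply/prodf_neq0 => i _; have [] := aP i.
apply: functional_extensionality_dep => j; have [c cE] := qpi_surj (z j).
rewrite [LHS](_ : _ = (\prod_i a i) *: z j) // cE -(linear_atZ _ _ (@qpi_linear _ _ _)).
apply/qpi_eq0; rewrite (bigD1 j) //= -[_ *: _]/(_ * _ * c) mulrAC -mulrA.
by rewrite mulrC; apply: ideal_mull; have [] := aP j.
Qed.

End ElementaryModule.

(** * Existence of a pseudo-isomorphism to an elementary module *)

Section Existence.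
Variable R : idomainType.
Hypotheses (nR : noetherian R) (kR : krull R).
Variable N : lmodType R.
Hypotheses (fN : fin_gen N) (tN : torsion N).

(* The quotient of N by X admits a pseudo-isomorphism to an elementary module. *)
Definition decomposed (X : set N) : Prop :=
  exists (d : prime_powers R) (F : N -> elementary_module d),
  [/\ linear F, forall x, X x -> F x = 0,
      forall q, height_one_prime q -> forall x, F x = 0 -> sat q X x
    & forall q, height_one_prime q -> forall z,
        exists2 u : R, u \notin q & exists y, u *: z = F y].

Lemma decomposed_null X : (forall q, height_one_prime q -> forall x, sat q X x) -> decomposed X.
Proof.
move=> nX; have no (i : 'I_0) : False by case: i.
exists (@PrimePowers R 0 (fun=> ideal_one R) (fun=> 0%N)
  (fun i => False_ind _ (no i)) (fun i => False_ind _ (no i))), (fun=> 0); split=> //.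
- by move=> a x y; rewrite scaler0 addr0.
- by move=> q hq x _; exact: nX.
move=> q [Hq _ _] z; exists 1; first exact: prime_ideal1.
by exists 0; apply: functional_extensionality_dep => -[].
Qed.

(* At p, the element x of maximal order modulo X splits off as a factor A/p^e; since
   Ax vanishes modulo X at every other height one prime, N/X is pseudo-isomorphic to
   the sum of A/p^e and N/(X + Ax). *)
Lemma decomposed_step X : submod_set X ->
  ~ (forall q, height_one_prime q -> forall x, sat q X x) ->
  exists x, ~ X x /\ (decomposed (addset X (line x)) -> decomposed X).
Proof.
move=> HX nX.
have [p [x0 [hp nx0]]] : exists p x0, height_one_prime p /\ ~ sat p X x0.
  apply: contrapT => np; apply: nX => q hq x; apply: contrapT => nx; apply: np.
  by exists q, x.
have Hp : prime_ideal p by case: hp.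
have [v Hv] := krull_valuation kR hp.
have [e [x [e0 xe eN xq]]] := max_order kR fN tN hp Hv HX nx0.
have [f lf [fX [s sp fx]]] := hom_to_cyclic nR fN hp Hv HX xe eN.
exists x; split=> [Xx|[d [F [lF FX Fker Fim]]]].
  have [|/eqP|] := xe 1; rewrite ?scale1r ?oner_eq0 //.
  by rewrite (val_notin Hv) ?prime_ideal1 // leqn0 => /eqP e0'; rewrite e0' in e0.
have HX' : submod_set (addset X (line x)) by apply: submod_addset => //; exact: submod_line.
have Fx : F x = 0 by apply: FX; apply: addset_subr => //; exact: line_id.
exists (pp_cons d hp e0), (fun y => econs hp e0 (f y) (F y)); split.
- by move=> a y y'; rewrite lf lF econs_linear.
- move=> y Xy; apply/econs_eq0; rewrite fX // FX //.
  by apply: addset_subl => //; exact: submod_line.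
- move=> q hq y /econs_eq0[fy Fy]; have Hq : prime_ideal q by case: (hq).
  have [u uq [y1 [_ [Xy1 [r ->] uy]]]] := Fker q hq y Fy.
  have [qp|qp] := pselect (q =i p); last first.
    have [u' u'q Xx] := xq q hq qp; exists (u' * u); first exact: prime_ideal_notM.
    rewrite -scalerA uy scalerDr; apply: submod_setD => //; first exact: submod_setZ.
    by rewrite scalerA mulrC -scalerA; exact: submod_setZ.
  have rx : f (r *: x) = 0.
    have -> : r *: x = u *: y - y1 by rewrite uy addrAC subrr add0r.
    by rewrite linear_atB // linear_atZ // fy scaler0 fX // subr0.
  (* From f (r x) = 0 the product r s lies in p^e, so r has value at least e. It is then, at p, a
     multiple of some b with b x in X, so that r x lies in X at p. *)
  have {rx}re : vge v e r.
    move: rx; rewrite linear_atZ // fx -(linear_atZ _ _ (@qpi_linear _ _ _)).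
    move=> /qpi_eq0 rs; apply: (vge_notin Hv sp); rewrite mulrC.
    exact: (@ideal_exp_vge _ _ _ Hp Hv e (r * s) rs).
  have [b [b0 Xb vb]] := eN x.
  have [s' s'p [c E]] := val_dvd Hp Hv b0 (vge_le vb re).
  exists (s' * u); first by apply: prime_ideal_notM; rewrite // qp.
  rewrite -scalerA uy scalerDr scalerA E -scalerA.
  by apply: submod_setD => //; exact: submod_setZ.
- move=> q hq w; have [z0 [z ->]] := econs_surj w; have Hq : prime_ideal q by case: (hq).
  have [u uq [y uz]] := Fim q hq z.
  have [c cE] := qpi_surj (u *: z0 - f y).
  (* The element y' corrects the first component without touching the others: at p it is a multiple
     of x, which F kills; at any other q it is 0, as A/p^e vanishes there. *)
  suff [u' u'q [y' fy' Fy']] : exists2 u' : R, u' \notin q &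
      exists2 y', f y' = qpi _ (u' *: c) & F y' = 0.
    exists (u' * u); first exact: prime_ideal_notM.
    exists (u' *: y + y'); rewrite lf lF Fy' addr0 -uz scalerA -econsZ; congr econs.
    rewrite fy' (linear_atZ _ _ (@qpi_linear _ _ _)) -cE -scalerDr.
    by rewrite addrC subrK scalerA.
  have [qp|qp] := pselect (q =i p).
    exists s; first by rewrite qp.
    exists (c *: x); last by rewrite linear_atZ // Fx scaler0.
    rewrite linear_atZ // fx -(linear_atZ _ _ (@qpi_linear _ _ _)); congr qpi.
    by rewrite -[LHS]/(c * s) mulrC.
  have [u' u'p u'q] : exists2 u : R, u \in p & u \notin q.
    apply: contrapT => nu; apply: qp => a.
    have pq : {subset p <= q}.
      by move=> b bp; apply: contrapT => /negP bq; apply: nu; exists b.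
    apply/idP/idP => [|/pq //]; apply: (height_one_min hq Hp (height_one_neq0 hp) pq).
  exists (u' ^+ e); first exact: prime_ideal_notX.
  exists 0; rewrite ?linear_at0 //; apply/esym/qpi_eq0.
  rewrite -[_ *: _]/(u' ^+ e * c) mulrC; apply: ideal_mull; exact: ideal_exp_mem.
Qed.

(** Noetherian induction from above: a largest X that is not decomposed would be strictly enlarged
    by [decomposed_step]. *)
Lemma decomposed_all X : submod_set X -> decomposed X.
Proof.
move=> HX; apply: contrapT => nX.
pose P Y := submod_set Y /\ ~ decomposed Y.
have [Y [[HY nY] _ maxY]] := @noeth_max _ _ P X (noeth_module nR fN) (fun _ H => H.1) (conj HX nX).
have [|x [nYx stepx]] := decomposed_step HY; first by move=> /decomposed_null.
have HY' : submod_set (addset Y (line x)) by apply: submod_addset => //; exact: submod_line.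
apply: nYx; apply: (maxY (addset Y (line x))).
- by split=> // /stepx.
- by apply: addset_subl; exact: submod_line.
- by apply: addset_subr => //; exact: line_id.
Qed.

Lemma fin_gen_quotmodule (V : lmodType R) (S : submodClosed V) :
  fin_gen V -> fin_gen (quotmodule S).
Proof.
move=> [n [g gV]]; exists n, (fun i => qpi S (g i)) => z.
have [x ->] := qpi_surj z; have [a ->] := gV x; exists a.
have q0 := linear_at0 (@qpi_linear _ _ S).
elim/big_ind2: _ => // [_ y1 _ y2 <- <-|i _].
  by have := @qpi_linear _ _ S 1 y1 y2; rewrite !scale1r.
by rewrite (linear_atZ _ _ (@qpi_linear _ _ _)).
Qed.

Lemma exists_pseudo_isomorphism : exists d, pseudo_isomorphic N (elementary_module d).
Proof.
have [d [F [lF _ Fker Fim]]] := decomposed_all (@submod_set1 _ N).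
exists d; pose f : {linear N -> elementary_module d} :=
  HB.pack F (GRing.isLinear.Build _ _ _ _ F lF).
exists f; split; apply/pseudo_nullP; split.
- apply/fin_gen_submoduleP; apply: noeth_module => //; exact: submod_set_mem.
- move=> x; have [a a0 ax] := tN (val x); exists a => //.
  by apply: val_inj; rewrite linearZ.
- move=> q hq x; have [|u uq ux] := Fker q hq (val x); first exact/eqP/(valP x).
  by exists u => //; apply: val_inj; rewrite linearZ.
- exact/fin_gen_quotmodule/elem_fin_gen.
- move=> z; have [x ->] := qpi_surj z; have [a a0 ax] := elem_torsion x.
  exists a => //; rewrite -(linear_atZ _ _ (@qpi_linear _ _ _)) ax.
  by rewrite (linear_at0 (@qpi_linear _ _ _)).
- move=> q hq z; have [x ->] := qpi_surj z; have [u uq [y uy]] := Fim q hq x.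
  exists u => //; rewrite /= -(linear_atZ _ _ (@qpi_linear _ _ _)) uy.
  by apply/qpi_eq0; rewrite unfold_in; apply/asboolP; exists y.
Qed.

End Existence.

(** * Ideal products, and characteristic ideals in terms of lengths *)

Section IdealMonoid.
Variable R : idomainType.
Implicit Types I J K : ideal R.

(** Leibniz equality, by proof irrelevance, is what makes ideal multiplication a commutative monoid
    law for big operators. *)
Lemma ideal_ext I J : I =i J -> I = J.
Proof.
case: I J => [f cf] [g cg] /= E.
have fg : f = g by apply: functional_extensionality_dep => x; exact: E.
subst g; congr GRing.SubmodClosed.Pack.
case: cf cg => [[a] [b]] [[a'] [b']].
by rewrite (Prop_irrelevance a a') (Prop_irrelevance b b').
Qed.

Lemma ideal_mul_sub I J K :
  (forall x y : R, x \in I -> y \in J -> x * y \in K) -> {subset ideal_mul I J <= K}.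
Proof.
move=> IJK x; rewrite unfold_in => /asboolP[s [/allP sP ->]]; rewrite big_seq_cond.
apply: (submod_set_sum (submod_set_mem K)) => u; rewrite andbT => /sP/andP[].
exact: IJK.
Qed.

Definition ideal_mul_alias (I J : ideal_alias R) : ideal_alias R := ideal_mul I J.
Definition ideal_one_alias : ideal_alias R := ideal_one R.

Fact ideal_mulC : commutative ideal_mul_alias.
Proof.
move=> I J; apply: ideal_ext => x; apply/idP/idP; apply: ideal_mul_sub => a b aI bJ;
  rewrite mulrC; exact: ideal_mul_mem.
Qed.

Fact ideal_mulA : associative ideal_mul_alias.
Proof.
suff sub (I J K : ideal_alias R) :
    {subset ideal_mul_alias I (ideal_mul_alias J K) <=
            ideal_mul_alias (ideal_mul_alias I J) K}.
  move=> I J K; apply: ideal_ext => x; apply/idP/idP; first exact: sub.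
  rewrite (ideal_mulC (ideal_mul_alias I J) K) (ideal_mulC I J) => /sub.
  by rewrite (ideal_mulC (ideal_mul_alias K J) I) (ideal_mulC K J).
apply: ideal_mul_sub => a y aI yJK.
have HX : submod_set [set y : R^o | a * y \in ideal_mul (ideal_mul I J) K].
  split=> [|b z w /= Hz Hw]; first by rewrite /= mulr0; exact: (@rpred0 R^o).
  by rewrite mulrDr -[b *: z]/(b * z) mulrCA; apply: (@rpredD R^o) => //; exact: ideal_mull.
move: yJK; rewrite unfold_in => /asboolP[s [/allP sP ->]]; rewrite big_seq_cond.
apply: (submod_set_sum HX) => u; rewrite andbT => /sP/andP[u1 u2] /=.
by rewrite mulrA; do 2!apply: ideal_mul_mem => //.
Qed.

Fact ideal_mul1 : left_id ideal_one_alias ideal_mul_alias.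
Proof.
move=> I; apply: ideal_ext => x; apply/idP/idP => [|xI].
  by apply: ideal_mul_sub => a b _; exact: ideal_mull.
by rewrite -[x]mul1r; exact: ideal_mul_mem.
Qed.

HB.instance Definition _ := Monoid.isComLaw.Build (ideal_alias R) ideal_one_alias
  ideal_mul_alias ideal_mulA ideal_mulC ideal_mul1.

End IdealMonoid.

Section CharIdeal.
Variable R : idomainType.
Hypotheses (nR : noetherian R) (kR : krull R).
Implicit Types (p q : ideal R) (d : prime_powers R) (N : lmodType R).

(** The multiset of the primes with their exponents: the total exponent of p becomes a multiplicity,
    independent of indexing and of repeated primes. *)
Definition pp_seq d : seq (ideal_alias R) :=
  flatten [seq nseq (pp_exp i) (pp_prime i : ideal_alias R) | i <- index_enum 'I_(pp_size d)].

Lemma pp_seq_height_one d q : q \in (pp_seq d : seq (ideal_alias R)) -> height_one_prime q.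
Proof.
by move=> /flatten_mapP[i _]; rewrite mem_nseq => /andP[_ /eqP->]; exact: pp_height_one.
Qed.

Lemma count_pp_seq d (p : ideal_alias R) :
  count_mem p (pp_seq d) =
  (\sum_(i < pp_size d) (if (pp_prime i : ideal_alias R) == p then pp_exp i else 0))%N.
Proof.
rewrite count_flatten sumnE !big_map; apply: eq_bigr => i _.
by rewrite count_nseq /=; case: ifP => _; rewrite ?mul1n ?mul0n.
Qed.

Lemma prime_powers_prodE d :
  prime_powers_prod d = \big[@ideal_mul_alias R/ideal_one_alias R]_(q <- pp_seq d) q.
Proof.
rewrite big_flatten big_map.
apply: (@eq_bigr (ideal_alias R)) => i _; rewrite big_nseq.
by elim: (pp_exp i) => //= n ->.
Qed.

(** The multiplicity of p is the least value at p on the product, so the ideal determines it. A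
    factor q other than p has an element outside p, which contributes value 0. *)
Lemma prod_val (s : seq (ideal_alias R)) p v :
  {in s, forall q : ideal_alias R, height_one_prime q} ->
  height_one_prime p -> valuation_at p v ->
  let P := \big[@ideal_mul_alias R/ideal_one_alias R]_(q <- s) q in
  (forall x, x \in P -> vge v (count_mem (p : ideal_alias R) s) x) /\
  exists x : R, [/\ x \in P, x != 0 & v x = count_mem (p : ideal_alias R) s].
Proof.
move=> + hp Hv /=; have Hp : prime_ideal p by case: hp.
elim: s => [|q s IH] hs.
  rewrite big_nil; split=> [x _|]; first exact: vge0.
  by exists 1; rewrite oner_neq0 (val_notin Hv) // prime_ideal1.
have [|IH1 [x [xP x0 vx]]] := IH; first by move=> q' q's; apply: hs; rewrite inE q's orbT.
have hq : height_one_prime q by apply: hs; rewrite mem_head.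
rewrite big_cons /=; split.
  move=> y; rewrite unfold_in => /asboolP[l [/allP lP ->]]; rewrite big_seq_cond.
  apply: (submod_set_sum (submod_vge Hp Hv _)) => u; rewrite andbT => /lP/andP[u1 u2].
  apply: (vge_mul Hv); last exact: IH1.
  by case: eqVneq => [qp|_]; [apply/(vge1_in Hv); rewrite -(_ : q = p)|exact: vge0].
have [w [wq w0 vw]] : exists w : R, [/\ w \in q, w != 0 & v w = (q == (p : ideal_alias R))].
  case: eqVneq => [qp|qp].
    have [u [u0 up vu]] := val_unif Hp Hv; exists u; split=> //; first by rewrite qp.
    by rewrite -[u]expr1 vu.
  have [w wq wp] : exists2 w : R, w \in q & w \notin p.
    apply: contrapT => nw; move/eqP: qp; apply; apply: ideal_ext => z.
    have qp : {subset q <= p}.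
      by move=> b bq; apply: contrapT => /negP bp; apply: nw; exists b.
    apply/idP/idP => [/qp //|]; apply: (height_one_min hp _ (height_one_neq0 hq) qp).
    by case: hq.
  by exists w; rewrite (notin_neq0 wp) (val_notin Hv wp).
exists (w * x); rewrite mulf_neq0 // (valM Hv) // vw vx; split=> //.
exact: ideal_mul_mem.
Qed.

Lemma prime_powers_prod_eq d d' :
  prime_powers_prod d =i prime_powers_prod d' <->
  forall p, height_one_prime p ->
    count_mem (p : ideal_alias R) (pp_seq d) = count_mem (p : ideal_alias R) (pp_seq d').
Proof.
rewrite !prime_powers_prodE; split=> [E p hp|E].
  have [v Hv] := krull_valuation kR hp.
  have Hp : prime_ideal p by case: hp.
  have [H1 [x1 [x1P x10 vx1]]] := prod_val (@pp_seq_height_one d) hp Hv.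
  have [H2 [x2 [x2P x20 vx2]]] := prod_val (@pp_seq_height_one d') hp Hv.
  apply/eqP; rewrite eqn_leq; apply/andP; split; [rewrite -vx2|rewrite -vx1].
    by have := H1 x2; rewrite E => /(_ x2P)[/eqP|//]; rewrite (negPf x20).
  by have := H2 x1; rewrite -E => /(_ x1P)[/eqP|//]; rewrite (negPf x10).
suff pe : perm_eq (pp_seq d) (pp_seq d') by rewrite (perm_big _ pe).
apply/allP => q; rewrite mem_cat => /orP[] /pp_seq_height_one hq; apply/eqP; exact: E.
Qed.

Lemma char_idealP N : torsion N -> (exists d, pseudo_isomorphic N (elementary_module d)) ->
  exists d, pseudo_isomorphic N (elementary_module d) /\ char_ideal N = prime_powers_prod d.
Proof.
move=> tN exd; rewrite /char_ideal; case: asboolP => // _; case: pselect => // exd'.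
by case: cid => d Hd /=; exists d.
Qed.

Section LengthElementary.
Variables (p : ideal R) (v : R -> nat).
Hypotheses (hp : height_one_prime p) (Hv : valuation_at p v).
Let Hp : prime_ideal p. Proof. by case: hp. Qed.

(** Filter by the submodules X j supported on the first j coordinates. The j-th graded piece is A
    modulo a power of the j-th prime; it has the exponent as length if this prime is p, and vanishes
    at p otherwise. *)
Lemma len_elementary d :
  len p [set (0 : elementary_module d)] setT = count_mem (p : ideal_alias R) (pp_seq d).
Proof.
set E := elementary_module d; pose n := pp_size d.
have flE : finlen p [set (0 : E)] setT.
  exact: (finlen_fin_gen Hp Hv (@elem_fin_gen R d) (@elem_torsion R d)).
pose X j : set E := [set z : E | forall i : 'I_n, (j <= i)%N -> z i = 0].
have HX j : submod_set (X j).
  split=> // a x y Hx Hy i ji; rewrite [LHS](_ : _ = a *: x i + y i) //.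
  by rewrite Hx // Hy // scaler0 addr0.
pose F (i : 'I_n) := if (pp_prime i : ideal_alias R) == p then pp_exp i else 0%N.
have lenX j : (j <= n)%N -> len p [set 0] (X j) = (\sum_(i < n | (i < j)%N) F i)%N.
  elim: j => [_|j IH jn].
    rewrite big1 // len_sat // => z Hz; apply: (sub_sat Hp).
    by apply: functional_extensionality_dep => i; exact: Hz.
  have XX : X j `<=` X j.+1 by move=> z Hz i /ltnW; exact: Hz.
  have s0 : [set (0 : E)] `<=` X j by move=> _ ->; exact: submod_set0.
  rewrite (lenD Hp (submod_set1 _) (HX j) (HX _) s0 XX); last exact: finlen_mono flE.
  rewrite (IH (ltnW jn)); pose oj := Ordinal jn.
  rewrite [RHS](bigD1 oj) //= addnC; congr (_ + _)%N; last first.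
    by apply: eq_bigl => i; rewrite [RHS]andbC ltnS -val_eqE -ltn_neqAle.
  pose delta : E := fun i => qpi _ ((i == oj)%:R : R^o).
  have deltaE i (c : R^o) : (c *: delta) i = qpi (ideal_exp (pp_prime i) (pp_exp i)) (c * (i == oj)%:R : R^o).
    by rewrite [LHS](_ : _ = c *: delta i) // -(linear_atZ _ _ (@qpi_linear _ _ _)).
  have lf : linear (fun c : R^o => (c : R) *: delta) by move=> a x y; rewrite scalerDl scalerA.
  pose I := ideal_exp (pp_prime oj) (pp_exp oj).
  have sI : [set c | c \in I] `<=` [set: R^o] by [].
  have fX (c : R^o) : [set: R^o] c -> X j.+1 ((c : R) *: delta).
    move=> _ i ji; rewrite deltaE; apply/qpi_eq0.
    case: eqVneq => [ij|_]; first by rewrite ij ltnn in ji.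
    by rewrite mulr0; exact: (@rpred0 R^o).
  have fs (z : E) : X j.+1 z -> exists2 c : R^o, [set: R^o] c & X j (z - (c : R) *: delta).
    move=> Hz; have [c zE] := qpi_surj (z oj); exists c => // i ji.
    rewrite [LHS](_ : _ = z i - ((c : R) *: delta) i) // deltaE.
    case: (eqVneq i oj) => [->|ioj]; first by rewrite zE mulr1 subrr.
    rewrite Hz; last by rewrite ltn_neqAle ji andbT eq_sym -(_ : (i == oj) = (val i == j)).
    rewrite mulr0 sub0r; apply/eqP; rewrite oppr_eq0; apply/eqP/qpi_eq0.
    exact: (@rpred0 R^o).
  have fY (c : R^o) : [set: R^o] c -> ([set c | c \in I] c <-> X j ((c : R) *: delta)).
    move=> _; split=> [cI i ji|/(_ oj (leqnn _))]; rewrite deltaE; last first.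
      by rewrite eqxx mulr1 => /qpi_eq0.
    case: (eqVneq i oj) => [->|ioj]; apply/qpi_eq0; first by rewrite mulr1.
    by rewrite mulr0; exact: (@rpred0 R^o).
  have [_ <-] := len_map p lf (submod_setT _) (submod_set_mem I) (HX _) (HX _) sI XX fX fs fY.
  rewrite /F /I; case: eqVneq => [->|np]; first exact: (len_ideal_exp Hp Hv).
  have hj := @pp_height_one R d oj.
  have [w wj wp] : exists2 w : R, w \in pp_prime oj & w \notin p.
    apply: contrapT => nw; move/eqP: np; apply; apply: ideal_ext => x.
    have jp : {subset pp_prime oj <= p}.
      by move=> b bj; apply: contrapT => /negP bp; apply: nw; exists b.
    apply/idP/idP => [/jp //|]; apply: (height_one_min hp _ (height_one_neq0 hj) jp).
    by case: hj.
  apply: len_sat => x _; exists (w ^+ pp_exp oj); first exact: prime_ideal_notX.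
  rewrite /= -[_ *: x]/(w ^+ pp_exp oj * x) mulrC.
  by apply: ideal_mull; exact: ideal_exp_mem.
have -> : [set: E] = X n.
  by apply/predeqP => z; split=> // _ i; rewrite leqNgt ltn_ord.
by rewrite lenX // count_pp_seq; apply: eq_bigl => i; rewrite ltn_ord.
Qed.

(** The kernel and the cokernel vanish at p, and the quotient by the kernel is the image. *)
Lemma len_pseudo_isomorphic (N E : lmodType R) :
    fin_gen N -> torsion N -> fin_gen E -> torsion E -> pseudo_isomorphic N E ->
  len p [set (0 : N)] setT = len p [set (0 : E)] setT.
Proof.
move=> fN tN fE tE [f [/pseudo_nullP[_ _ ker0] /pseudo_nullP[_ _ coker0]]].
have flN := finlen_fin_gen Hp Hv fN tN; have flE := finlen_fin_gen Hp Hv fE tE.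
have lf : linear f by move=> a x y; rewrite linearP.
pose K : set N := [set x | f x = 0]; pose J : set E := [set y | exists x, y = f x].
have HK : submod_set K.
  by split=> [|a x y]; rewrite /K /= ?linear0 // linearP => -> ->; rewrite scaler0 addr0.
have HJ : submod_set J.
  split=> [|a _ _ [x ->] [y ->]]; first by exists 0; rewrite linear0.
  by exists (a *: x + y); rewrite linearP.
have K0 : [set (0 : N)] `<=` K by move=> _ ->; exact: submod_set0.
have J0 : [set (0 : E)] `<=` J by move=> _ ->; exact: submod_set0.
rewrite (lenD Hp (submod_set1 _) HK (submod_setT _) K0 (@subsetT _ _)) //.
rewrite (lenD Hp (submod_set1 _) HJ (submod_setT _) J0 (@subsetT _ _)) //.
rewrite [X in (X + _)%N]len_sat => [|x Kx]; last first.
  have xK : x \in lin_kernel f by exact/eqP.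
  have [s sp sx] := ker0 p hp (Sub x xK); exists s => //.
  by move: (congr1 val sx); rewrite linearZ SubK.
rewrite [X in _ = (_ + X)%N]len_sat => [|y _]; last first.
  have [s sp sy] := coker0 p hp (qpi _ y); exists s => //.
  move: sy; rewrite /= -(linear_atZ _ _ (@qpi_linear _ _ _)) => /qpi_eq0.
  by rewrite unfold_in => /asboolP.
rewrite add0n addn0.
have fX x : [set: N] x -> J (f x) by exists x.
have fs y : J y -> exists2 x, [set: N] x & [set (0 : E)] (y - f x).
  by move=> [x ->]; exists x => //=; rewrite subrr.
have [_ //] := len_map p lf (submod_setT _) HK HJ (submod_set1 _) (@subsetT _ _) J0 fX fs
  (fun x _ => iff_refl _).
Qed.

End LengthElementary.

Lemma char_ideal_eq (N N' : lmodType R) :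
    fin_gen N -> torsion N -> fin_gen N' -> torsion N' ->
  char_ideal N =i char_ideal N' <->
  forall p, height_one_prime p -> len p [set (0 : N)] setT = len p [set (0 : N')] setT.
Proof.
move=> fN tN fN' tN'.
have [d [Nd ->]] := char_idealP tN (exists_pseudo_isomorphism nR kR fN tN).
have [d' [Nd' ->]] := char_idealP tN' (exists_pseudo_isomorphism nR kR fN' tN').
rewrite prime_powers_prod_eq; split=> E p hp; have [v Hv] := krull_valuation kR hp.
  rewrite (len_pseudo_isomorphic hp Hv fN tN (elem_fin_gen d) (@elem_torsion _ d) Nd).
  rewrite (len_pseudo_isomorphic hp Hv fN' tN' (elem_fin_gen d') (@elem_torsion _ d') Nd').
  by rewrite !(len_elementary hp Hv) E.
rewrite -!(len_elementary hp Hv).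
rewrite -(len_pseudo_isomorphic hp Hv fN tN (elem_fin_gen d) (@elem_torsion _ d) Nd).
rewrite -(len_pseudo_isomorphic hp Hv fN' tN' (elem_fin_gen d') (@elem_torsion _ d') Nd').
exact: E.
Qed.

End CharIdeal.

(** * Power series: successive approximation, noetherianity, Cayley-Hamilton *)

Section PowerSeriesTheory.
Variable A : idomainType.
Local Notation B := (fps A).
Local Notation t := (fps_t A).
Implicit Types f g b : B.

Lemma fpsE f g : (forall n, coefs f n = coefs g n) -> f = g.
Proof. by move/fpsP. Qed.

Lemma coefsM f g n : coefs (f * g) n = \sum_(j < n.+1) coefs f j * coefs g (n - j)%N.
Proof. by []. Qed.

Lemma coefsD f g n : coefs (f + g) n = coefs f n + coefs g n. Proof. by []. Qed.
Fact coefs0_is_zmod_morphism : zmod_morphism (fun f : B => coefs f 0%N).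
Proof. by []. Qed.
Fact coefs0_is_monoid_morphism : monoid_morphism (fun f : B => coefs f 0%N).
Proof. by split=> // f g; rewrite /= big_ord1. Qed.
Definition coef0 (f : B) : A := coefs f 0%N.
HB.instance Definition _ := GRing.isZmodMorphism.Build B A coef0 coefs0_is_zmod_morphism.
HB.instance Definition _ := GRing.isMonoidMorphism.Build B A coef0 coefs0_is_monoid_morphism.

Lemma coefs_const a f n : coefs (fps_const a * f) n = a * coefs f n.
Proof.
by rewrite coefsM big_ord_recl /= subn0 big1 ?addr0 // => i _; rewrite mul0r.
Qed.

Lemma coefs_t f n : coefs (t * f) n = if n is m.+1 then coefs f m else 0.
Proof.
rewrite coefsM; case: n => [|n]; first by rewrite big_ord1 mul0r.
rewrite big_ord_recl mul0r add0r big_ord_recl /= subn1 mul1r big1 ?addr0 //.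
by move=> i _; rewrite mul0r.
Qed.

Lemma t_neq0 : t != 0.
Proof. by apply/eqP => /fpsP/(_ 1%N)/eqP; rewrite /= oner_eq0. Qed.

Definition fps_tail (f : B) : B := Fps (fun n => coefs f n.+1).

Lemma fps_tailE f : f = fps_const (coef0 f) + t * fps_tail f.
Proof.
by apply: fpsE => -[|n]; rewrite coefsD coefs_t ?addr0 // [X in X + _]/= add0r.
Qed.

Lemma coef0_eq0 f : coef0 f = 0 <-> exists g, f = t * g.
Proof.
split=> [f0|[g ->]]; last by rewrite rmorphM /= mul0r.
by exists (fps_tail f); rewrite {1}[f]fps_tailE f0 rmorph0 add0r.
Qed.

(** The constants chosen for the successive remainders are the coefficients of the series C k i. The
    error satisfies D k = t D (k+1), hence is divisible by every power of t and vanishes. *)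
Lemma span_complete (J : set B) (s : seq B^o) :
  (forall y, J y -> exists (c : nat -> A) y', J y' /\
     y = \sum_(i < size s) fps_const (c i) * (s`_i : B) + t * y') ->
  forall y, J y -> span s (y : B^o).
Proof.
move=> step.
have /choice[F HF] : forall y, exists cy : (nat -> A) * B, J y -> J cy.2 /\
    y = \sum_(i < size s) fps_const (cy.1 i) * (s`_i : B) + t * cy.2.
  move=> y; case: (pselect (J y)) => [/step[c [y' H]]|nJ]; first by exists (c, y').
  by exists (fun=> 0, 0).
move=> y Jy; pose Y k := iter k (fun z => (F z).2) y.
have JY k : J (Y k) by elim: k => //= k /HF[].
pose C k i : B := Fps (fun j => (F (Y (k + j)%N)).1 i).
have CE k i : C k i = fps_const ((F (Y k)).1 i) + t * C k.+1 i.
  by apply: fpsE => -[|n]; rewrite coefsD coefs_t /= ?addn0 ?addr0 // add0r addnS.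
pose D k := Y k - \sum_(i < size s) C k i * (s`_i : B).
have DE k : D k = t * D k.+1.
  rewrite /D mulrBr {1}(HF _ (JY k)).2 mulr_sumr -/(Y k.+1).
  under [X in _ - X]eq_bigr do rewrite CE mulrDl -mulrA.
  by rewrite big_split /= opprD addrACA subrr add0r.
have D0 n k : coefs (D k) n = 0.
  by elim: n k => [|n IH] k; rewrite DE coefs_t.
exists (C 0%N); apply/eqP; rewrite -subr_eq0; apply/eqP.
by apply: (@fpsE (D 0%N) 0) => n; rewrite D0.
Qed.

Lemma span_restrict (M : lmodType B) (s : seq M) (x : M) :
  @span A (restrict_scalars M (@fps_const A)) s x -> span s x.
Proof. by move=> [c ->]; exists (fun i => fps_const (c i)). Qed.

(* J1 is the union of the (J : t^k), and is generated by lifts of generators of its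
   ideal of constant terms. As t^n J1 is contained in J for some n, the ideal J is
   generated by t^n J1 and by its intersection with a finitely generated A-module. *)
Lemma noetherian_fps : noetherian A -> noetherian B.
Proof.
move=> nA I; apply/fin_gen_submoduleP; pose J : set B := [set x | x \in I].
have HJ : submod_set (J : set B^o) by exact: submod_set_mem.
have JM a x : J x -> J (a * x) by exact: ideal_mull.
have JD x y : J x -> J y -> J (x + y) by exact: (submod_setD HJ).
have JB x y : J x -> J y -> J (x - y) by exact: (submod_setB HJ).
pose J1 : set B := [set y | exists k, J (t ^+ k * y)].
have J1le k m y : (k <= m)%N -> J (t ^+ k * y) -> J (t ^+ m * y).
  by move=> km; rewrite -(subnK km) exprD -mulrA; exact: JM.
have J1M a y : J1 y -> J1 (a * y) by move=> [k Jk]; exists k; rewrite mulrCA; exact: JM.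
have J1D x y : J1 x -> J1 y -> J1 (x + y).
  move=> [k Jx] [m Jy]; exists (maxn k m); rewrite mulrDr; apply: JD.
    by apply: J1le Jx; rewrite leq_maxl.
  by apply: J1le Jy; rewrite leq_maxr.
have J1N x : J1 x -> J1 (- x) by rewrite -mulN1r; exact: J1M.
pose I0 : set A^o := [set a | exists2 y, J1 y & coef0 y = a].
have HI0 : submod_set I0.
  split=> [|a _ _ [y Jy <-] [z Jz <-]].
    by exists 0; [exists 0%N; rewrite mulr0; exact: submod_set0 HJ|rewrite rmorph0].
  exists (fps_const a * y + z); last by rewrite rmorphD rmorphM.
  by apply: J1D => //; exact: J1M.
have [s0 s0E] := noeth_ring nA HI0.
have /choice[h Hh] : forall a, exists y, I0 a -> J1 y /\ coef0 y = a.
  move=> a; case: (pselect (I0 a)) => [[y Jy ya]|nI]; first by exists y.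
  by exists 0.
pose s : seq B^o := map h s0.
have s0I (i : nat) : (i < size s0)%N -> I0 s0`_i by move=> si; apply/s0E/mem_span/mem_nth.
have hs (i : 'I_(size s0)) : J1 (h s0`_i) by apply: (Hh _ _).1; exact: s0I.
have step y : J1 y -> exists (c : nat -> A) y', J1 y' /\
    y = \sum_(i < size s) fps_const (c i) * (s`_i : B) + t * y'.
  move=> Jy; have /s0E[c yc] : I0 (coef0 y) by exists y.
  pose w := \sum_(i < size s) fps_const (c i) * (s`_i : B).
  have Jw : J1 w.
    rewrite /w size_map; elim/big_ind: _ => [||i _]; [|exact: J1D|].
      by exists 0%N; rewrite mulr0; exact: submod_set0 HJ.
    by apply: J1M; rewrite (nth_map 0).
  have /coef0_eq0[y' yE] : coef0 (y - w) = 0.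
    rewrite rmorphB /= yc /w size_map rmorph_sum -sumrB big1 // => i _.
    rewrite [X in _ - X](coefs_const (c i) s`_i 0) (nth_map 0) //.
    by rewrite -/(coef0 _) (Hh _ (s0I _ _)).2 // subrr.
  exists c, y'; split; last by rewrite -/w -yE addrC subrK.
  have [k Jk] : J1 (y - w) by apply: J1D => //; exact: J1N.
  by exists k.+1; rewrite exprSr -mulrA -yE.
have J1s : forall y, J1 y -> span s (y : B^o) := span_complete step.
have [n Jn] : exists n, forall y, J1 y -> J (t ^+ n * y).
  have [n sn] : exists n, {in s, forall x, J (t ^+ n * x)}.
    have : {in s, forall x, J1 x}.
      by move=> _ /mapP[a as0 ->]; apply: (Hh _ _).1; apply/s0E/mem_span.
    elim: s {J1s step} => [|g s IH] sJ; first by exists 0%N.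
    have [n Jn] := sJ g (mem_head _ _).
    have [|m sm] := IH; first by move=> x xs; apply: sJ; rewrite inE xs orbT.
    exists (maxn n m) => x; rewrite inE => /orP[/eqP->|/sm].
      by apply: J1le Jn; rewrite leq_maxl.
    by apply: J1le; rewrite leq_maxr.
  exists n => y /J1s; apply: (@span_sub _ _ s [set y : B^o | J (t ^+ n * (y : B))]) => //.
  split=> [|a x z /= Jx Jz]; first by rewrite /= mulr0; exact: submod_set0 HJ.
  rewrite mulrDr; apply: JD => //; rewrite -[a *: x]/(a * x) mulrCA; exact: JM.
pose rB : lmodType A := restrict_scalars (B^o : lmodType B) (@fps_const A).
(* Iterating [step] n times writes J1 as the A-span of a finite list L plus t^n J1: at stage i the
   list gains the multiples of s by t^i. *)
have [L HL] : exists L : seq rB, forall y, J1 y ->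
    exists w y' : B, [/\ span L (w : rB), J1 y' & y = w + t ^+ n * y'].
  elim: n {Jn} => [|n [L IH]].
    by exists [::] => y Jy; exists 0, y; split=> //; [exact/span_nil|rewrite mul1r add0r].
  exists (L ++ [seq ((t ^+ n * (x : B)) : rB) | x <- s]) => y /IH[w [y' [Lw Jy' ->]]].
  have [c [y2 [Jy2 ->]]] := step _ Jy'.
  exists (w + t ^+ n * \sum_(i < size s) fps_const (c i) * (s`_i : B)), y2; split=> //.
    apply: (submod_setD (submod_span _)).
      by apply: span_mono Lw => x xL; rewrite mem_cat xL.
    rewrite mulr_sumr; apply: (@submod_set_sum A rB _ (submod_span _)) => i _.
    rewrite mulrCA; apply: (@submod_setZ A rB _ (submod_span _) (c i)).
    by apply: mem_span; rewrite mem_cat map_f ?orbT // mem_nth.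
  by rewrite mulrDr addrA exprSr mulrA.
have HJA : submod_set (J : set rB).
  by split=> [|a x y Jx Jy]; [exact: submod_set0 HJ|apply: JD => //; exact: JM].
have [s1 s1E] := @noeth_span A rB L (J `&` span L) (noeth_ring nA)
  (submod_setI HJA (submod_span L)) (@subIsetr _ _ _).
pose s2 : seq B^o := s1 ++ [seq ((t ^+ n * (x : B)) : B^o) | x <- s].
have Jsub : {in s2, forall x, J x}.
  move=> x; rewrite mem_cat => /orP[/(@mem_span A rB)/s1E[]//|/mapP[z zs ->]].
  apply: Jn; move: zs => /mapP[a as0 ->]; apply: (Hh _ _).1; exact/s0E/mem_span.
exists s2 => x; split; last exact: (span_sub HJ Jsub).
move=> Jx; have [|w [y' [Lw Jy' xE]]] := HL x; first by exists 0%N; rewrite mul1r.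
have Jw : J w by rewrite -[w](addrK (t ^+ n * y')) -xE; apply: JB => //; exact: Jn.
rewrite xE; apply: (submod_setD (submod_span _)).
  have s12 : {subset (s1 : seq B^o) <= s2} by move=> z zs1; rewrite mem_cat zs1.
  apply: (@span_mono B B^o s1 s2 s12 w); apply: (@span_restrict (B^o : lmodType B) s1 w).
  by apply/s1E.
have [c yE] := J1s _ Jy'; rewrite [X in _ * X]yE mulr_sumr.
apply: (submod_set_sum (submod_span _)) => i _.
rewrite -[c i *: _]/(c i * _) mulrCA; apply: (@submod_setZ B B^o _ (submod_span _)).
by apply: mem_span; rewrite mem_cat (map_f (fun x : B => t ^+ n * x)) ?orbT // mem_nth.
Qed.

Section CayleyHamilton.
Variable M : lmodType B.

(* Cayley-Hamilton: D = det (s - t b), where s w_i = t sum_j b_ij w_j. *)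
Lemma annihilator_of_t_multiple (w : seq M) (s : A) :
  (forall x, span w x -> exists2 x', span w x' & fps_const s *: x = t *: x') ->
  exists D k, coef0 D = s ^+ k /\ forall x, span w x -> D *: x = 0.
Proof.
move=> Hw; pose n := size w.
have /choice[b bE] : forall i : 'I_n, exists b : nat -> B,
    fps_const s *: w`_i = t *: \sum_(j < n) b j *: w`_j.
  move=> i; have [|x' [c ->] ->] := Hw w`_i; first exact/mem_span/mem_nth.
  by exists c.
pose D : 'M[B]_n := (fps_const s)%:M - \matrix_(i, j) (t * b i j).
have Dw i : \sum_j D i j *: w`_j = 0.
  under eq_bigr do rewrite !mxE scalerBl.
  rewrite sumrB (bigD1 i) //= eqxx mulr1n big1 ?addr0 => [|j ji]; last first.
    by rewrite eq_sym (negPf ji) mulr0n scale0r.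
  rewrite bE scaler_sumr; apply/eqP; rewrite subr_eq0; apply/eqP.
  by apply: eq_bigr => j _; rewrite scalerA.
have detw (k : 'I_n) : \det D *: w`_k = 0.
  have : \sum_i (\adj D) k i *: \sum_j D i j *: w`_j = 0.
    by rewrite big1 // => i _; rewrite Dw scaler0.
  under eq_bigr do rewrite scaler_sumr; rewrite exchange_big /=.
  under eq_bigr do under eq_bigr do rewrite scalerA.
  under eq_bigr do rewrite -scaler_suml.
  have adjD j : \sum_i (\adj D) k i * D i j = (\det D *+ (k == j)).
    by have /matrixP/(_ k j) := mul_adj_mx D; rewrite !mxE.
  under eq_bigr do rewrite adjD.
  rewrite (bigD1 k) //= eqxx mulr1n big1 ?addr0 // => j jk.
  by rewrite eq_sym (negPf jk) mulr0n scale0r.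
exists (\det D), n; split.
  rewrite -det_map_mx (_ : map_mx _ D = s%:M) ?det_scalar //.
  apply/matrixP => i j; rewrite !mxE.
  transitivity (coef0 (fps_const s *+ (i == j)) - coef0 (t * b i j)); first exact: rmorphB.
  rewrite [X in _ - X](coefs_t _ 0) subr0.
  by case: (i == j).
move=> _ [c ->]; rewrite scaler_sumr big1 // => i _.
by rewrite scalerA mulrC -scalerA detw scaler0.
Qed.

End CayleyHamilton.
End PowerSeriesTheory.

(** * The Euler characteristic of an endomorphism *)

Section EulerCharacteristic.
Variables (A : idomainType) (p : ideal A).
Hypothesis Hp : prime_ideal p.
Variables (V : lmodType A) (tau : V -> V) (Z : set V).
Hypotheses (ltau : linear tau) (HZ : submod_set Z) (tauZ : forall z, Z z -> Z (tau z)).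

(** Z plays the role of 0: this is the preimage in V of the image of tau^k on V/Z, and K below is
    the preimage of the kernel of tau on V/Z. *)
Fixpoint tau_filtration (k : nat) : set V :=
  if k is m.+1 then addset (tau @` tau_filtration m) Z else setT.

Local Notation F := tau_filtration.
Let K : set V := [set x | Z (tau x)].

Lemma submod_tau_filtration k : submod_set (F k).
Proof. by elim: k => //= k IH; apply: submod_addset => //; exact: submod_image. Qed.

Lemma tau_filtration_sub k : F k.+1 `<=` F k.
Proof.
elim: k => // k IH; apply: addset_sub; first exact: submod_tau_filtration.
  move=> _ [x Fx <-]; apply: addset_subl => //; exists x => //; exact: IH.
by apply: addset_subr; apply: submod_image => //; exact: submod_tau_filtration.
Qed.

Lemma sub_tau_filtration k : Z `<=` F k.
Proof.
case: k => // k; apply: addset_subr; apply: submod_image => //.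
exact: submod_tau_filtration.
Qed.

Lemma tau_filtrationP k x : F k x <-> exists y, Z (x - iter k tau y).
Proof.
elim: k x => [|k IH] x; first by split=> // _; exists x; rewrite subrr; exact: submod_set0.
split=> [[_ [z [[w /IH[y Hy] <-] Zz ->]]]|[y Hy]].
  exists y; rewrite addrAC /= -linear_atB //; apply: submod_setD => //; exact: tauZ.
exists (iter k.+1 tau y), (x - iter k.+1 tau y); split=> //; last by rewrite [RHS]addrC subrK.
by exists (iter k tau y) => //; apply/IH; exists y; rewrite subrr; exact: submod_set0.
Qed.

Let submodK : submod_set K. Proof. exact: submod_preimage. Qed.

(** Let Y consist of the elements of F k that tau sends into F (k+2). Then tau identifies F k / Y
    with F (k+1) / F (k+2), and inclusion identifies (K meet F k) / (K meet F (k+1)) with Y / F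
    (k+1). *)
Lemma chi_step k : finlen p (F k.+1) (F k) -> finlen p Z K ->
  finlen p (F k.+2) (F k.+1) /\
  (len p (F k.+1) (F k) + len p Z (K `&` F k.+1) =
   len p (F k.+2) (F k.+1) + len p Z (K `&` F k))%N.
Proof.
move=> fF fK; have HF := submod_tau_filtration.
pose Y : set V := F k `&` tau @^-1` F k.+2.
have HY : submod_set Y by apply: submod_setI => //; exact: submod_preimage.
have FY : F k.+1 `<=` Y.
  move=> x Fx; split; first exact: tau_filtration_sub.
  by apply: addset_subl => //; exists x.
have YF : Y `<=` F k by move=> x [].
have [E1 ->] : (finlen p Y (F k) <-> finlen p (F k.+2) (F k.+1)) /\
    len p (F k.+2) (F k.+1) = len p Y (F k).
  have [? ->] : (finlen p Y (F k) <-> finlen p (F k.+2) (F k.+1)) /\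
      len p Y (F k) = len p (F k.+2) (F k.+1); last by [].
  apply: (len_map p ltau) => //.
  - exact: tau_filtration_sub.
  - by move=> x Fx; apply: addset_subl => //; exists x.
  - move=> _ [_ [z [[w Fw <-] Zz ->]]]; exists w => //.
    by rewrite addrAC subrr add0r; exact: (@sub_tau_filtration k.+2).
  - by move=> x Fx; split=> [[]|].
split; first by apply/E1; exact: finlen_mono fF.
have sKF j : Z `<=` K `&` F j.
  by move=> z Zz; split; [exact: tauZ|exact: sub_tau_filtration].
have HKF j : submod_set (K `&` F j) by exact: submod_setI.
have sKK : K `&` F k.+1 `<=` K `&` F k by move=> x [Kx Fx]; split=> //; exact: tau_filtration_sub.
have [_ E2] : (finlen p (K `&` F k.+1) (K `&` F k) <-> finlen p (F k.+1) Y) /\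
    len p (K `&` F k.+1) (K `&` F k) = len p (F k.+1) Y.
  apply: (@len_map _ _ _ _ (fun x => x)) => //.
  - by move=> x [Kx Fx]; split=> //; apply: (@sub_tau_filtration k.+2 (tau x) Kx).
  - move=> x [Fx [_ [z [[w Fw <-] Zz tx]]]]; exists (x - w).
      split; first by rewrite /K /= linear_atB // tx addrAC subrr add0r.
      by apply: submod_setB => //; exact: tau_filtration_sub.
    by rewrite opprB addrCA subrr addr0.
  - by move=> x [Kx Fx]; split=> [[]|].
rewrite (lenD Hp (HF _) HY (HF _) FY YF fF) -E2.
have fKk : finlen p Z (K `&` F k) by apply: finlen_mono fK => // x [].
rewrite [len p Z (K `&` F k)](lenD Hp HZ (HKF k.+1) (HKF k) (sKF _) sKK fKk).
by rewrite addnAC addnC [X in (_ + X)%N = _]addnC.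
Qed.

Lemma chi_iter k : finlen p (F 1) (F 0) -> finlen p Z K ->
  finlen p (F k.+1) (F k) /\
  (len p (F 1) (F 0) + len p Z (K `&` F k) = len p (F k.+1) (F k) + len p Z K)%N.
Proof.
move=> fF fK; elim: k => [|k [fk IH]].
  by split=> //; congr (_ + len p Z _)%N; apply/predeqP => x; split=> [[]|].
have [fk1 E] := chi_step fk fK; split=> //; move: E IH.
move: (len _ _ (F 0)) (len _ _ (F k)) (len _ _ (F k.+1)) (len _ Z K).
move: (len _ Z (K `&` F k)) (len _ Z (K `&` F k.+1)) => y x a f f' z E IH.
apply/eqP; rewrite -(eqn_add2r (f + y)) {1}[(f + y)%N]addnC addnACA IH.
by rewrite [(x + f)%N]addnC E addnACA [X in _ == X]addnACA [(f + f')%N]addnC.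
Qed.

(** The last hypothesis makes tau injective on F n modulo Z, so the kernel term of [chi_iter]
    disappears. *)
Lemma chi_eq0 n : finlen p (F 1) (F 0) -> finlen p Z K -> K `&` F n `<=` Z ->
  len p (F 1) (F 0) = len p Z K <-> F n `<=` sat p (F n.+1).
Proof.
move=> fF fK KZ; have HF := submod_tau_filtration.
have [fn E] := chi_iter n fF fK; have FF := @tau_filtration_sub n.
have K0 : len p Z (K `&` F n) = 0%N.
  by apply: len_sat => x /KZ; exact: (sub_sat Hp).
rewrite K0 addn0 in E; rewrite E -[X in _ = X]add0n.
split=> [/eqP|H]; last by rewrite (len_sat H).
rewrite eqn_add2r => /eqP.
by apply: (len_eq0 (Z := F n)) => //.
Qed.

End EulerCharacteristic.

(** * Height one primes of the power series ring *)

Section Krull.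
Variable A : idomainType.
Hypotheses (nA : noetherian A) (kA : krull A).
Local Notation B := (fps A).
Local Notation t := (fps_t A).
Implicit Types (p : ideal A) (Q : ideal B).

Lemma krull_dvd (a c : A) : c != 0 ->
  (forall p, height_one_prime p -> exists2 i : A, i \notin p & exists d, a * i = c * d) ->
  exists d, a = c * d.
Proof.
move=> c0 H; case: kA => rE _ _.
have Fc : tofrac c != 0 :> {fraction A} by rewrite tofrac_eq0.
have : range (@tofrac A) (tofrac a / tofrac c).
  rewrite rE => p hp; have [i ip [d E]] := H p hp.
  exists d, i; split=> //; have Fi : tofrac i != 0 by rewrite tofrac_eq0 (notin_neq0 ip).
  by apply/eqP; rewrite eqr_div // -!tofracM E mulrC.
move=> [d _ E]; exists d; apply/eqP; rewrite -tofrac_eq tofracM E.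
by rewrite mulrC divfK.
Qed.

(** The series with zero constant term form the nonzero prime tB; inside a height one prime Q it
    would be all of Q, against the constant term of f. *)
Lemma t_notin Q f : height_one_prime Q -> f \in Q -> coef0 f != 0 -> t \notin Q.
Proof.
move=> hQ fQ f0; apply/negP => tQ.
pose X : set B^o := [set g | coef0 g = 0].
have HX : submod_set X.
  split=> [|a x y x0 y0]; first exact: (rmorph0 (@coef0 A)).
  by have := rmorphD (@coef0 A) (a * x) y; rewrite rmorphM /= x0 y0 mulr0 addr0.
have inX g : (g \in (submod_set_pred HX : ideal B)) <-> coef0 g = 0 by exact: in_submod_set.
have HT : prime_ideal (submod_set_pred HX : ideal B).
  apply: prime_idealI => [|x y /inX]; first by apply/negP => /inX/eqP; rewrite rmorph1 oner_eq0.
  by rewrite rmorphM => /eqP; rewrite mulf_eq0 => /orP[]/eqP/inX -> //.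
have TQ : {subset (submod_set_pred HX : ideal B) <= Q}.
  by move=> g /inX/coef0_eq0[h ->]; rewrite mulrC ideal_mull.
have T0 : exists2 x, x \in (submod_set_pred HX : ideal B) & x != 0.
  by exists t; [exact/inX|exact: t_neq0].
by have /inX/eqP := height_one_min hQ HT T0 TQ fQ; rewrite (negPf f0).
Qed.

(* Q is the annihilator (f : y) of some y modulo f. If no height one prime
   contained the constant terms of Q, then y(0) would be a multiple of f(0), so that
   y is in fB + tB; iterating, y is in fB. *)
Lemma height_one_over Q f : height_one_prime Q -> f \in Q -> coef0 f != 0 ->
  exists2 p, height_one_prime p & forall g, g \in Q -> coef0 g \in p.
Proof.
move=> hQ fQ f0; have HQ : prime_ideal Q by case: hQ.
have fn0 : f != 0 by apply: contraNneq f0 => ->; rewrite rmorph0.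
apply: contrapT => np.
have {}np p : height_one_prime p -> exists2 g, g \in Q & coef0 g \notin p.
  move=> hp; apply: contrapT => ng; apply: np; exists p => // g gQ.
  by apply: contrapT => /negP gp; apply: ng; exists g.
pose C y : set B^o := [set x | exists b, (x : B) * y = f * b].
have HC y : submod_set (C y).
  split=> [|a x z [b xb] [c zc]]; first by exists 0; rewrite mul0r mulr0.
  exists (a * b + c); rewrite mulrDl -[a *: x * y]/(a * x * y) -mulrA xb zc mulrDr.
  by rewrite mulrCA.
pose P (I : set B^o) := exists y, I = C y /\ forall x, C y x -> (x : B) \in Q.
have [|//|_ [[y [-> yQ]] _ maxy]] := @noeth_max _ _ P (C 1) (noeth_ring (noetherian_fps nA)).
- by move=> _ [y [-> _]].
- by exists 1; split=> // x [b]; rewrite mulr1 => ->; rewrite mulrC ideal_mull.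
have max_mul s : C (s * y) `<=` C y \/ exists2 x : B, C (s * y) x & x \notin Q.
  case: (pselect (forall x, C (s * y) x -> (x : B) \in Q)) => [H|H]; [left|right].
    apply: maxy; first by exists (s * y).
    by move=> x [b xb]; exists (s * b); rewrite mulrCA xb mulrCA.
  apply: contrapT => nx; apply: H => x Cx; apply: contrapT => /negP xQ.
  by apply: nx; exists x.
pose I : ideal B := submod_set_pred (HC y).
have inI x : (x \in I) <-> C y x by exact: in_submod_set.
have C1 : ~ C y 1 by move=> /yQ; apply/negP; exact: prime_ideal1.
(* I is maximal among the annihilators modulo f contained in Q. If a b is in I but neither factor
   is, some s outside Q kills a y modulo f, then some u outside Q kills s y, and u s kills y
   although it is outside Q. *)
have HI : prime_ideal I.
  apply: prime_idealI => [|a b /inI[c abc] aI bI]; first by apply/negP => /inI.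
  have [/(_ b)H|[s [d sd] sQ]] := max_mul a.
    by move/negP: bI; apply; apply/inI/H; exists c; rewrite mulrA [b * a]mulrC.
  have [/(_ a)H|[u [d' ud] uQ]] := max_mul s.
    by move/negP: aI; apply; apply/inI/H; exists d; rewrite mulrCA.
  have /yQ : C y (u * s) by exists d'; rewrite -mulrA.
  by apply/negP; exact: prime_ideal_notM.
have fI : f \in I by apply/inI; exists y.
have QI : {subset Q <= I}.
  by apply: height_one_min hQ HI _ _ => [|x /inI /yQ //]; exists f.
(* J is the ideal (fB : Q). Successive approximation shows that it equals fB, so y, which lies in J,
   would have annihilator B. *)
pose J : set B := [set z | forall q, q \in Q -> exists b, q * z = f * b].
have Jy : J y by move=> q /QI/inI.
have [//|c yE] := @span_complete A J [:: (f : B^o)] _ y Jy; last first.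
  by apply: C1; exists (c 0%N); rewrite mul1r yE big_ord1 mulrC.
move=> z Jz; have [a za] : exists a, coef0 z = coef0 f * a.
  apply: krull_dvd => // p hp; have [g gQ gp] := np p hp; exists (coef0 g) => //.
  have [b E] := Jz g gQ; exists (coef0 b).
  by move/(congr1 (@coef0 A)): E; rewrite !rmorphM /= mulrC.
have /coef0_eq0[z' zE] : coef0 (z - fps_const a * f) = 0.
  transitivity (coef0 z - coef0 (fps_const a * f)); first exact: rmorphB.
  by rewrite za [X in _ - X](coefs_const a f 0) mulrC subrr.
exists (fun=> a), z'; split; last by rewrite big_ord1 -zE addrC subrK.
move=> q qQ; have [b E] := Jz q qQ.
(* This keeps z' in J: f(0) is nonzero, so the second factor on the right is divisible by t and t
   can be cancelled. *)
have E' : t * (q * z') = f * (b - q * fps_const a).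
  by rewrite mulrCA -zE mulrBr E mulrBr; congr (_ - _); rewrite mulrA mulrC.
have /coef0_eq0[b' bE] : coef0 (b - q * fps_const a) = 0.
  apply/eqP; move/(congr1 (@coef0 A))/eqP: E'; rewrite !rmorphM /= mul0r eq_sym mulf_eq0.
  by rewrite (negPf f0).
by exists b'; apply: (mulfI (t_neq0 A)); rewrite E' bE mulrCA.
Qed.

End Krull.

(** * Annihilation by some t^k s with s(0) outside p *)

Section HeightTwo.
Variable A : idomainType.
Hypotheses (nA : noetherian A) (kA : krull A).
Local Notation B := (fps A).
Local Notation t := (fps_t A).
Implicit Types (p : ideal A) (Q : ideal B).

Lemma t_power_stable (V : lmodType B) (Z : set V) : noeth V -> submod_set Z ->
  exists n, forall k x, Z (t ^+ (k + n) *: x) -> Z (t ^+ n *: x).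
Proof.
move=> nV HZ; pose W k : set V := [set x | Z (t ^+ k *: x)].
have HW k : submod_set (W k).
  split=> [|a x y Wx Wy]; first by rewrite /W /= scaler0; exact: submod_set0.
  rewrite /W /= scalerDr scalerA mulrC -scalerA.
  by apply: submod_setD => //; exact: submod_setZ.
pose P X := exists k, X = W k.
have [|//|_ [[n ->] _ maxn]] := @noeth_max _ _ P (W 0%N) nV; first by move=> _ [k ->].
  by exists 0%N.
exists n => k x Hx; apply: (maxn (W (k + n)%N)) Hx => // [|y Wy]; first by exists (k + n)%N.
by rewrite /W /= exprD -scalerA; exact: submod_setZ.
Qed.

Lemma coef0_constMD (a : A) (x y : B) : coef0 (fps_const a * x + y) = a * coef0 x + coef0 y.
Proof. by rewrite rmorphD; congr (_ + _); exact: coefs_const. Qed.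

(** Divide by t until the constant term is nonzero; the quotients stay in Q because t is not in
    Q. *)
Lemma exists_coef0_neq0 Q : prime_ideal Q -> (exists2 g, g \in Q & g != 0) -> t \notin Q ->
  exists2 g, g \in Q & coef0 g != 0.
Proof.
move=> HQ [g gQ g0] tQ.
have [n gn] : exists n, coefs g n != 0.
  apply: contrapT => H; move/eqP: g0; apply; apply: fpsE => n.
  by apply/eqP; apply: contrapT => /negP gn; apply: H; exists n.
elim: n g gQ {g0} gn => [|n IH] g gQ gn; first by exists g.
case: (eqVneq (coef0 g) 0) => [|g0]; last by exists g.
move=> /coef0_eq0[g' gE]; apply: (IH g'); last by move: gn; rewrite gE coefs_t.
by move: gQ; rewrite gE => /(prime_idealM HQ); exact.
Qed.

Local Notation rB := (restrict_scalars (B^o : lmodType B) (@fps_const A)).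

Lemma submod_restrict (V : lmodType B) (X : set V) : submod_set X ->
  @submod_set A (restrict_scalars V (@fps_const A)) X.
Proof. by move=> [X0 XD]; split=> // a; exact: XD. Qed.

Definition fps_scale (V : lmodType B) (b : B) (x : restrict_scalars V (@fps_const A)) :
  restrict_scalars V (@fps_const A) := b *: (x : V).

Lemma linear_fps_scale (V : lmodType B) (b : B) : linear (@fps_scale V b).
Proof.
move=> a x y; rewrite /fps_scale [LHS](_ : _ = b *: (fps_const a *: (x : V) + y)) //.
by rewrite scalerDr scalerA mulrC -scalerA.
Qed.

Section PrimePair.
Variables (p : ideal A) (Q1 : ideal B) (h : B).
Hypotheses (hp : height_one_prime p) (HQ1 : prime_ideal Q1).
Hypotheses (Q1n : exists2 g, g \in Q1 & g != 0) (tQ1 : t \notin Q1) (hQ1 : h \notin Q1).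

Let Z : set rB := [set x | exists q c, (q : B) \in Q1 /\ (x : B) = q + h * c].
Let T : set rB := [set x | exists q c, (q : B) \in Q1 /\ (x : B) = q + t * c].

Fact submod_pair (b : B) :
  @submod_set B B^o [set x | exists q c, (q : B) \in Q1 /\ (x : B) = q + b * c].
Proof.
split=> [|a _ _ [q [c [qQ ->]]] [q' [c' [qQ' ->]]]].
  by exists 0, 0; rewrite mulr0 addr0; split=> //; exact: (@rpred0 B^o Q1).
exists (a * q + q'), (a * c + c'); split.
  by apply: (@rpredD B^o Q1) => //; exact: ideal_mull.
rewrite -[X in X + _ = _]/(a * (q + b * c)) !mulrDr addrACA; congr (_ + (_ + _)).
exact: mulrCA.
Qed.

(* In the domain C = B / Q1 the elements t and h give
   (hC : t) / hC = (tC : h) / tC, the kernel of h on C / tC, which at p has the same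
   finite length as its cokernel C / (h, t). *)
Lemma height_two : exists k (s : B), coef0 s \notin p /\ Z (t ^+ k * s).
Proof.
have Hp : prime_ideal p by case: hp.
have [v Hv] := krull_valuation kA hp.
have HZ := submod_restrict (submod_pair h).
have HT := submod_restrict (submod_pair t).
pose tau : rB -> rB := @fps_scale B^o t.
have ltau : linear tau := @linear_fps_scale B^o t.
pose eta : rB -> rB := @fps_scale B^o h.
have leta : linear eta := @linear_fps_scale B^o h.
have tauZ z : Z z -> Z (tau z).
  by apply: (submod_setZ (submod_pair h) t).
pose K : set rB := [set x | Z (tau x)].
pose H : set rB := [set x | T (eta x)].
have HK : submod_set K := submod_preimage ltau HZ.
have HH : submod_set H := submod_preimage leta HT.
pose F := tau_filtration tau Z.
have HF k : submod_set (F k) := submod_tau_filtration ltau HZ k.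
have QT q : q \in Q1 -> T q by move=> qQ; exists q, 0; rewrite mulr0 addr0.
have QZ q : q \in Q1 -> Z q by move=> qQ; exists q, 0; rewrite mulr0 addr0.
have tT c : T (t * c) by exists 0, c; rewrite add0r; split=> //; exact: (@rpred0 B^o Q1).
have hZ c : Z (h * c) by exists 0, c; rewrite add0r; split=> //; exact: (@rpred0 B^o Q1).
have TH : T `<=` H by move=> x; apply: (submod_setZ (submod_pair t) h).
have TF : T `<=` F 1%N.
  by move=> _ [q [c [qQ ->]]]; exists (t * c), q; split; [exists c|exact: QZ|rewrite addrC].
(* B/(Q1 + tB) is A/I0, where I0 is the ideal of constant terms of Q1; it is nonzero, so the length
   at p is finite. *)
have fT : finlen p T setT.
  have [g gQ g0] := exists_coef0_neq0 HQ1 Q1n tQ1.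
  pose I0 : set A^o := [set a | exists2 q : B, q \in Q1 & coef0 q = a].
  have HI0 : submod_set I0.
    split=> [|a _ _ [x xQ <-] [y yQ <-]].
      by exists 0; [exact: (@rpred0 B^o Q1)|exact: rmorph0].
    exists (fps_const a * x + y); last exact: coef0_constMD.
    by apply: (@rpredD B^o Q1) => //; exact: ideal_mull.
  have l0 : linear (fun b : rB => coef0 (b : B) : A^o).
    by move=> a x y; exact: coef0_constMD.
  have [E _] : (finlen p T setT <-> finlen p I0 setT) /\ len p T setT = len p I0 setT.
    apply: (len_map p l0) => //.
    - by move=> a _; exists (fps_const a) => //; rewrite subrr; exact: submod_set0.
    - move=> b _; split=> [[q [c [qQ ->]]]|[q qQ bq]].
        by exists q => //; rewrite rmorphD [X in _ + X](coefs_t c 0) addr0.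
      have /coef0_eq0[c cE] : coef0 (b - q) = 0 by rewrite rmorphB /= bq subrr.
      by exists q, c; rewrite -cE addrC subrK.
  by apply/E; apply: (finlen_ideal Hp Hv g0) => //; exists g.
have fF : finlen p (F 1%N) (F 0%N) by exact: finlen_mono fT.
have fTH : finlen p T H by exact: finlen_mono fT.
(* Cancellation in the domain B/Q1: from a c = b d and c = b c' follows d = a c'. It serves for (t,
   h) and for (h, t). *)
have KH_rel (a b : B) c d : a \notin Q1 -> b \notin Q1 ->
    (a * c - b * d) \in Q1 -> (exists q c', (q : B) \in Q1 /\ c = q + b * c') ->
    exists q d', (q : B) \in Q1 /\ d = q + a * d'.
  move=> aQ bQ abQ [q [c' [qQ cE]]]; exists (d - a * c'), c'; split; last by rewrite subrK.
  apply: (prime_idealM HQ1 _ bQ).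
  have -> : b * (d - a * c') = a * q - (a * c - b * d).
    rewrite cE [a * (q + _)]mulrDr mulrBr opprB [RHS]addrCA; congr (_ + _).
    by rewrite opprD addrA subrr add0r mulrCA.
  by apply: (submod_setB (submod_set_mem Q1)) => //; exact: ideal_mull.
have [E lE] : (finlen p Z K <-> finlen p T H) /\ len p Z K = len p T H.
  apply: (@len_rel A p _ _ (fun c d : rB => (t * (c : B) - h * (d : B)) \in Q1)) => //.
  - move=> a x x' y y' Hx Hy.
    have -> : t * ((a *: x + y : rB) : B) - h * ((a *: x' + y' : rB) : B) =
        fps_const a * (t * (x : B) - h * (x' : B)) + (t * (y : B) - h * (y' : B)).
      rewrite [X in t * X]/(fps_const a * x + y) [X in h * X]/(fps_const a * x' + y').
      by rewrite !mulrDr opprD addrACA mulrN [t * _]mulrCA [h * (_ * _)]mulrCA.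
    by apply: (@rpredD B^o Q1) => //; exact: ideal_mull.
  - move=> c [q [d [qQ tc]]]; exists d; last by rewrite (tc : t * c = _) addrK.
    change (T (h * d)).
    have -> : h * d = t * c - q by rewrite (tc : t * c = _) addrC addKr.
    by apply: (submod_setB HT); [exact: tT|exact: QT].
  - move=> d [q [c [qQ hd]]]; exists c.
      change (Z (t * c)).
      have -> : t * c = h * d - q by rewrite (hd : h * d = _) addrC addKr.
      by apply: (submod_setB HZ); [exact: hZ|exact: QZ].
    rewrite (hd : h * d = _) opprD addrCA subrr addr0.
    by apply: (submod_setN (submod_set_mem Q1)).
  - move=> c d _ _ Hcd; split; first exact: KH_rel.
    by apply: KH_rel => //; rewrite -opprB; exact: (submod_setN (submod_set_mem Q1)).
have fK : finlen p Z K by apply/E.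
have l1 : len p H setT = len p T (F 1%N).
  have [_ //] : (finlen p H setT <-> finlen p T (F 1%N)) /\ len p H setT = len p T (F 1%N).
  apply: (len_map p leta) => //.
  - by move=> x _; apply: (sub_tau_filtration ltau HZ 1%N); exact: hZ.
  - move=> _ [_ [_ [[c _ <-] [q [d [qQ ->]]] ->]]]; exists d => //.
    rewrite addrA addrK; apply: (submod_setD HT); [exact: tT|exact: QT].
(* The length of B/T is computed through H and through F 1. Since h identifies B/H with F 1 / T, the
   length of B / F 1 is that of H/T, which is that of K/Z. *)
have lF : len p (F 1%N) (F 0%N) = len p Z K.
  rewrite lE; apply/eqP; rewrite -(eqn_add2r (len p H setT)).
  rewrite -(lenD Hp HT HH (submod_setT _) TH (@subsetT _ _) fT) l1 addnC.
  by rewrite -(lenD Hp HT (HF _) (submod_setT _) TF (@subsetT _ _) fT).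
have nB : noeth B^o := noeth_ring (noetherian_fps nA).
have [n Hn] := t_power_stable nB (submod_pair h).
have iterE k x : iter k tau x = t ^+ k * (x : B).
  by elim: k => [|k IH] /=; rewrite ?mul1r // IH exprS -mulrA.
have KF : K `&` F n `<=` Z.
  move=> x [Kx /(tau_filtrationP ltau HZ tauZ)[y Zxy]].
  have Zy : Z (t ^+ (1 + n) * (y : B)).
    rewrite exprS -mulrA -iterE.
    have -> : t * (iter n tau y : B) = tau x - tau (x - iter n tau y).
      by rewrite -linear_atB // opprB addrCA subrr addr0.
    by apply: (submod_setB HZ) => //; exact: tauZ.
  rewrite -(subrK (iter n tau y) x); apply: (submod_setD HZ) => //.
  by rewrite iterE; exact: (Hn 1%N).
have /(_ (t ^+ n))[] := (chi_eq0 Hp ltau HZ tauZ fF fK KF).1 lF.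
  by apply/(tau_filtrationP ltau HZ tauZ); exists 1; rewrite iterE mulr1 subrr; exact: submod_set0.
move=> s sp /(tau_filtrationP ltau HZ tauZ)[y]; rewrite iterE => Zs.
(* From s t^n = t^(n+1) y modulo Z, the product of t^n with s - t y lies in Z. *)
have E0 : coef0 (fps_const s - t * (y : B)) = s.
  transitivity (coef0 (fps_const s) - coef0 (t * (y : B))); first exact: rmorphB.
  by rewrite [X in _ - X](coefs_t y 0) subr0.
exists n, (fps_const s - t * (y : B)); split.
  exact: (eq_ind_r (fun z : A => z \notin p) sp E0).
rewrite mulrBr mulrA -exprSr mulrC; exact: Zs.
Qed.

End PrimePair.

(** The elements t^k s with s(0) outside p are closed under multiplication, so an ideal maximal
    among those avoiding them is prime. As t is one of them, it is outside Q and outside the smaller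
    prime, as [height_two] requires. *)
Lemma exists_t_power (I : set B^o) (f : B) p : submod_set I -> I f -> coef0 f != 0 ->
  (forall Q, height_one_prime Q -> exists2 g : B, I g & g \notin Q) ->
  height_one_prime p -> exists k (s : B), coef0 s \notin p /\ I (t ^+ k * s).
Proof.
move=> HI If f0 nI hp; have Hp : prime_ideal p by case: hp.
apply: contrapT => nk.
pose P (J : set B^o) := submod_set J /\ forall k (s : B), coef0 s \notin p -> ~ J (t ^+ k * s).
have PI : P I by split=> // k s sp Ik; apply: nk; exists k, s.
have [X [[HX nX] IX maxX]] :=
  @noeth_max _ _ P I (noeth_ring (noetherian_fps nA)) (fun _ H => H.1) PI.
pose Q : ideal B := submod_set_pred HX.
have inQ x : (x \in Q) <-> X x by exact: in_submod_set.
have out a : a \notin Q -> exists k s (q c : B), [/\ coef0 s \notin p, X q & t ^+ k * s = q + c * a].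
  move=> aQ; apply: contrapT => na; move/negP: aQ; apply; apply/inQ.
  have HL : submod_set (addset X (line (a : B^o))) by apply: submod_addset => //; exact: submod_line.
  apply: (maxX (addset X (line (a : B^o)))).
  - split=> // k s sp [q [_ [Xq [c ->] E]]]; apply: na.
    by exists k, s, q, c.
  - by apply: addset_subl; exact: submod_line.
  - by apply: addset_subr => //; exact: line_id.
have HQ : prime_ideal Q.
  apply: prime_idealI => [|a b /inQ Xab /out[k [s [q [c [sp Xq E]]]]] /out[l [u [r [d [up Xr E']]]]]].
    apply/negP => /inQ; have := nX 0%N 1; rewrite mulr1; apply.
    by rewrite rmorph1; exact: prime_ideal1.
  apply: (nX (k + l)%N (s * u)); first by rewrite rmorphM; exact: prime_ideal_notM.
  have -> : t ^+ (k + l) * (s * u) = (t ^+ l * u) * q + ((c * a) * r + (c * d) * (a * b)).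
    rewrite exprD mulrACA E mulrDl [q * _]mulrC; congr (_ + _).
    by rewrite E' mulrDr; congr (_ + _); rewrite mulrACA.
  have XM z x : X x -> X (z * x) by exact: (submod_setZ HX z).
  by apply: (submod_setD HX); [exact: XM|apply: (submod_setD HX); exact: XM].
have fQ : f \in Q by apply/inQ/IX.
have fn0 : f != 0 by apply: contraNneq f0 => ->; rewrite rmorph0.
have nhQ : ~ height_one_prime Q.
  by move=> /nI[g /IX Xg /negP]; apply; apply/inQ.
have Q0 : exists2 g, g \in Q & g != 0 by exists f.
have tQ : t \notin Q.
  apply/negP => /inQ; have := nX 1%N 1; rewrite mulr1; apply.
  by rewrite rmorph1; exact: prime_ideal1.
have [Q1 [HQ1 Q1n Q1Q [h hQ hQ1]]] := prime_between HQ Q0 nhQ.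
have tQ1 : t \notin Q1 by apply: contra tQ => /Q1Q.
have [k [s [sp [q [c [qQ E]]]]]] := height_two hp HQ1 Q1n tQ1 hQ1.
apply: (nX k s sp); apply/inQ; rewrite E.
apply: (@rpredD B^o Q); first exact: Q1Q.
by rewrite mulrC; apply: ideal_mull.
Qed.

End HeightTwo.

(** * Pseudo-null modules over the power series ring *)

Section PseudoNull.
Variable A : idomainType.
Hypotheses (nA : noetherian A) (kA : krull A).
Local Notation B := (fps A).
Local Notation t := (fps_t A).
Variable M : lmodType B.
Hypotheses (fM : fin_gen M) (tM : torsion M).
Implicit Types p : ideal A.

Local Notation rM := (restrict_scalars M (@fps_const A)).

(** Stated for any n: a stabilizing n serves the equivalence, and n = 0 the last claim. At a height
    one prime Q where M survives, f is in Q, which provides p and keeps t outside Q. *)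
Lemma pseudo_null_of_sat (f : B) n : coef0 f != 0 -> (forall m : M, f *: m = 0) ->
  (forall p, height_one_prime p -> forall x : M, exists2 s : A, s \notin p &
    exists y, fps_const s *: (t ^+ n *: x) = t ^+ n.+1 *: y) ->
  pseudo_null M.
Proof.
move=> f0 fM0 Hsat; apply/pseudo_nullP; split=> // Q hQ m.
have HQ : prime_ideal Q by case: hQ.
apply: contrapT => nm.
have AQ g : (forall x : M, g *: x = 0) -> g \in Q.
  by move=> g0; apply: contrapT => /negP gQ; apply: nm; exists g => //=.
have fQ : f \in Q by exact: AQ.
have [p hp Qp] := height_one_over nA kA hQ fQ f0.
have Hp : prime_ideal p by case: hp.
have [sM ME] := (fin_genP M).1 fM.
pose w := [seq t ^+ n *: x | x <- sM].
have wE x : span w x <-> exists y, x = t ^+ n *: y.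
  split=> [|[y ->]].
    apply: (@span_sub B M w [set x | exists y, x = t ^+ n *: y]) => [|_ /mapP[y _ ->]]; last by exists y.
    split=> [|a _ _ [y ->] [z ->]]; first by exists 0; rewrite scaler0.
    by exists (a *: y + z); rewrite scalerDr !scalerA mulrC.
  have [c ->] := (ME y).1 I; rewrite scaler_sumr; apply: (submod_set_sum (submod_span _)) => i _.
  rewrite scalerA mulrC -scalerA; apply: (submod_setZ (submod_span _)).
  by apply/mem_span/map_f/mem_nth.
pose Y : set M := [set x | exists y, x = t ^+ n.+1 *: y].
have HY : submod_set Y.
  split=> [|a _ _ [y ->] [z ->]]; first by exists 0; rewrite scaler0.
  by exists (a *: y + z); rewrite scalerDr !scalerA mulrC.
(* A single s serves the generators w of t^n M; the inclusion then extends to their B-span because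
   t^(n+1) M is a B-submodule. *)
have [|s sp sY] := @sat_span A p rM Hp Y w (submod_restrict HY).
  move=> x /span_restrict/wE[y ->]; have [s sp [z E]] := Hsat p hp y.
  by exists s => //; exists z; rewrite -E.
have [x wx|D [k [Dk D0]]] := @annihilator_of_t_multiple A M w s.
  have [y sx] : Y (fps_const s *: x).
    apply: (@span_sub B M w [set x | Y (fps_const s *: x)]) wx => [|z zw].
      split=> [|a y z Hy Hz]; first by rewrite /= scaler0; exact: submod_set0.
      rewrite /= scalerDr scalerA mulrC -scalerA; apply: (submod_setD HY) => //.
      exact: submod_setZ.
    exact: (sY z (@mem_span A rM w z zw)).
  by exists (t ^+ n *: y); [apply/wE; exists y|rewrite sx exprS scalerA].
have /Qp : D \in Q.
  apply: contrapT => /negP DQ; apply: nm; exists (D * t ^+ n).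
    by apply: prime_ideal_notM => //; apply: prime_ideal_notX => //; exact: t_notin fQ f0.
  by rewrite /= -scalerA; apply: D0; apply/wE; exists m.
by rewrite Dk; apply/negP; exact: prime_ideal_notX.
Qed.

Lemma mod_t_eq0 (m : M) : @qpi A rM (@t_multiples_pred A M) m = 0 <-> exists y, m = t *: y.
Proof. by rewrite qpi_eq0 unfold_in; split=> /asboolP. Qed.

(** A nonzero a killing M/tM sends M into tM, so Cayley-Hamilton applies to generators of M; the
    constant term is a power of a. *)
Lemma exists_annihilator : fin_gen (mod_t M) -> torsion (mod_t M) ->
  exists2 f : B, coef0 f != 0 & forall m : M, f *: m = 0.
Proof.
move=> fMt tMt; have [a a0 aM] := ann_neq0 fMt tMt.
have [w wE] := (fin_genP M).1 fM.
have [x _|D [k [Dk D0]]] := @annihilator_of_t_multiple A M w a.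
  have /mod_t_eq0[y E] : @qpi A rM (@t_multiples_pred A M) (a *: (x : rM)) = 0.
    by rewrite (linear_atZ _ _ (@qpi_linear _ _ _)); exact: aM.
  by exists y; [apply/wE|exact: E].
by exists D => [|m]; [rewrite Dk expf_neq0|apply/D0/wE].
Qed.

(** B acts on M_t through constant terms. Hence generators of M_t over B also generate it over A,
    and f(0) kills it. *)
Lemma const_scale (f : B) (x : M) : t *: x = 0 -> f *: x = fps_const (coef0 f) *: x.
Proof.
move=> tx; rewrite {1}[f]fps_tailE scalerDl [t * _]mulrC -scalerA tx scaler0.
by rewrite addr0.
Qed.

Lemma t_torsion_torsion (f : B) : coef0 f != 0 -> (forall m : M, f *: m = 0) ->
  torsion (t_torsion M).
Proof.
move=> f0 fM0 x; exists (coef0 f) => //; apply: val_inj; rewrite linearZ.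
have tx : t *: (val x : M) = 0 by apply/eqP; exact: (valP x).
by rewrite -[RHS](fM0 (val x)) const_scale.
Qed.

Lemma t_torsion_fin_gen : fin_gen (t_torsion M).
Proof.
apply/fin_gen_submoduleP; pose K : set M := [set x | t *: x = 0].
have HK : submod_set K.
  split=> [|a x y Kx Ky]; first by rewrite /K /= scaler0.
  by rewrite /K /= scalerDr Ky addr0 scalerA mulrC -scalerA Kx scaler0.
have [s sE] := noeth_module (noetherian_fps nA) fM HK.
exists s => x; split=> [/eqP xK|/span_restrict/sE xK]; last exact/eqP.
have [c xE] := (sE x).1 xK; exists (fun i => coef0 (c i)).
rewrite [LHS]xE; apply: eq_bigr => i _; apply: const_scale.
exact/sE/mem_span/mem_nth.
Qed.

(** The Euler characteristic setting with V = M over A and Z = 0: the filtration is t^k M and K is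
    M_t. *)
Let tau : rM -> rM := @fps_scale A M t.
Let ltau : linear tau := @linear_fps_scale A M t.
Let Z : set rM := [set 0].
Let HZ : submod_set Z := @submod_set1 A rM.
Let tauZ z : Z z -> Z (tau z). Proof. by move=> ->; exact: (linear_at0 ltau). Qed.
Local Notation F := (tau_filtration tau Z).
Let K : set rM := [set x | Z (tau x)].

Lemma iter_fps_scale k (x : M) : iter k tau x = t ^+ k *: x.
Proof.
by elim: k => [|k IH] /=; rewrite ?expr0 ?scale1r // IH exprS -scalerA.
Qed.

Lemma t_filtrationP k (x : M) : F k x <-> exists y : M, x = t ^+ k *: y.
Proof.
rewrite (tau_filtrationP ltau HZ tauZ); split=> [[y xy]|[y ->]]; exists y.
  by rewrite -iter_fps_scale; exact: (subr0_eq xy).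
by rewrite iter_fps_scale; exact: (@subrr rM).
Qed.

Lemma len_mod_t p :
  (finlen p (F 1%N) (F 0%N) <-> finlen p [set (0 : mod_t M)] setT) /\
  len p (F 1%N) (F 0%N) = len p [set (0 : mod_t M)] setT.
Proof.
have lq : linear (@qpi A rM (@t_multiples_pred A M)) := @qpi_linear A rM _.
apply: (len_map p lq) => //.
- exact: (submod_tau_filtration ltau HZ 1%N).
- exact: submod_set1.
- by move=> z _; have [x ->] := qpi_surj z; exists x => //; rewrite subrr.
- by move=> x _; rewrite t_filtrationP expr1; apply: iff_sym; exact: mod_t_eq0.
Qed.

Lemma len_t_torsion p :
  (finlen p [set (0 : t_torsion M)] setT <-> finlen p Z K) /\
  len p [set (0 : t_torsion M)] setT = len p Z K.
Proof.
have lv : linear (val : t_torsion M -> rM) by move=> a x y; rewrite linearP.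
have HK : submod_set K := submod_preimage ltau HZ.
have ZK : Z `<=` K by move=> _ ->; exact: tauZ.
have fX (x : t_torsion M) : setT x -> K (val x) by move=> _; apply/eqP; exact: (valP x).
have fs (x : rM) : K x -> exists2 y : t_torsion M, setT y & Z (x - val y).
  move=> /eqP Kx; have xT : x \in @t_torsion_pred A M by exact: Kx.
  by exists (Submodule xT) => //; exact: (@subrr rM).
have fY (x : t_torsion M) : setT x -> ([set 0] x <-> Z (val x)).
  by move=> _; split=> [->|x0]; [exact: linear0|apply: val_inj; rewrite linear0; exact: x0].
exact: (len_map p lv (submod_setT _) (submod_set1 _) HK HZ (@subsetT _ _) ZK fX fs fY).
Qed.

Lemma len_eq_sat p n (f : B) : coef0 f != 0 -> (forall m : M, f *: m = 0) ->
    fin_gen (mod_t M) -> torsion (mod_t M) ->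
    (forall k (x : M), t ^+ (k + n) *: x = 0 -> t ^+ n *: x = 0) ->
    height_one_prime p ->
  len p [set (0 : t_torsion M)] setT = len p [set (0 : mod_t M)] setT <->
  forall x : M, exists2 s : A, s \notin p &
    exists y, fps_const s *: (t ^+ n *: x) = t ^+ n.+1 *: y.
Proof.
move=> f0 fM0 fMt tMt Hn hp; have Hp : prime_ideal p by case: hp.
have [v Hv] := krull_valuation kA hp.
have [E1 <-] := len_mod_t p; have [E2 ->] := len_t_torsion p.
have fF := E1.2 (finlen_fin_gen Hp Hv fMt tMt).
have fK := E2.1 (finlen_fin_gen Hp Hv t_torsion_fin_gen (t_torsion_torsion f0 fM0)).
have KF : K `&` F n `<=` Z.
  move=> x [Kx /t_filtrationP[y xE]]; rewrite xE; apply: (Hn 1%N).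
  by rewrite exprS -scalerA -xE; exact: Kx.
have E := chi_eq0 Hp ltau HZ tauZ fF fK KF.
split=> [/esym/E H x|H].
  have [|s sp /t_filtrationP[y Ey]] := H (t ^+ n *: x); first by apply/t_filtrationP; exists x.
  by exists s => //; exists y; rewrite -Ey.
apply/esym/E => _ /t_filtrationP[x ->]; have [s sp [y Ey]] := H x.
by exists s => //; apply/t_filtrationP; exists y; rewrite -Ey.
Qed.

Lemma sat_of_pseudo_null p n (f : B) : pseudo_null M ->
    coef0 f != 0 -> (forall m : M, f *: m = 0) ->
    (forall k (x : M), t ^+ (k + n) *: x = 0 -> t ^+ n *: x = 0) ->
    height_one_prime p ->
  forall x : M, exists2 s : A, s \notin p &
    exists y, fps_const s *: (t ^+ n *: x) = t ^+ n.+1 *: y.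
Proof.
move=> /pseudo_nullP[_ _ nM] f0 fM0 Hn hp x.
pose I : set B^o := [set b | forall m : M, (b : B) *: m = 0].
have HI : submod_set I.
  split=> [|a b c bI cI] m; first exact: scale0r.
  by rewrite scalerDl cI addr0 -scalerA bI scaler0.
have nI Q : height_one_prime Q -> exists2 g : B, I g & g \notin Q.
  move=> hQ; have HQ : prime_ideal Q by case: hQ.
  have [s sE] := (fin_genP M).1 fM.
  have [|g gQ gM] := @sat_span B Q M HQ [set 0] s (@submod_set1 _ M).
    by move=> y _; exact: nM.
  by exists g => // m; apply: gM; apply/sE.
have [k [s [sp sI]]] := exists_t_power nA kA HI fM0 f0 nI hp.
(* As t^k s kills M, so does t^n s by the choice of n. Writing s = s(0) + t s' gives s(0) t^n x = -
   t^(n+1) s' x. *)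
exists (coef0 s) => //; exists (- fps_tail s *: x).
have : t ^+ n *: (s *: x) = 0.
  by apply: (Hn k); rewrite addnC exprD -!scalerA [_ *: (s *: x)]scalerA sI scaler0.
rewrite scalerA mulrC -scalerA {1}[s]fps_tailE scalerDl => /eqP.
rewrite addr_eq0 => /eqP->; rewrite scaleNr scalerN; congr (- _).
by rewrite !scalerA exprS mulrAC.
Qed.

End PseudoNull.


Theorem corollary2p11 (A : idomainType) (M : lmodType (fps A)) :
  noetherian A -> krull A ->
  fin_gen M -> torsion M ->
  fin_gen (mod_t M) -> torsion (mod_t M) ->
  (pseudo_null M <-> char_ideal (t_torsion M) =i char_ideal (mod_t M)) /\
  (pseudo_null (mod_t M) -> pseudo_null M).
Proof.
move=> nA kA fM tM fMt tMt.
have [f f0 fM0] := exists_annihilator fM fMt tMt.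
(* The submodules killed by t^k stabilize at n, so t is injective on t^n M. *)
have [n Hn] := t_power_stable (noeth_module (noetherian_fps nA) fM) (@submod_set1 _ M).
have charE := char_ideal_eq nA kA (t_torsion_fin_gen nA fM) (t_torsion_torsion f0 fM0) fMt tMt.
have lenE p := len_eq_sat nA kA fM f0 fM0 fMt tMt Hn (p := p).
split; first split=> [nM|/charE E].
- by apply/charE => p hp; apply/lenE => //; exact: sat_of_pseudo_null fM0 Hn hp.
- by apply: (pseudo_null_of_sat nA kA fM tM f0 fM0) => p hp; apply/lenE => //; exact: E.
move=> /pseudo_nullP[_ _ nMt].
(* For n = 0 the condition is that some s outside p multiplies x into tM, which is the vanishing of
   M/tM at p. *)
apply: (pseudo_null_of_sat (n := 0) nA kA fM tM f0 fM0) => p hp x.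
have [s sp sx] := nMt p hp (@qpi A (restrict_scalars M (@fps_const A)) (@t_multiples_pred A M) x); exists s => //.
have /mod_t_eq0[y E] : @qpi A (restrict_scalars M (@fps_const A)) (@t_multiples_pred A M)
    (s *: (x : restrict_scalars M (@fps_const A))) = 0.
  by rewrite (linear_atZ _ _ (@qpi_linear _ _ _)); exact: sx.
by exists y; rewrite expr0 scale1r expr1; exact: E.
Qed.
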